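(* Let $1\le r<\infty$, let $\mathbb{F}_r$ be the free group on the set $\{a_1,\dots,a_r\}$ of free generators, and put $S=\{a_1^{\pm1},\dots,a_r^{\pm1}\}$. Let $\mu$ be a Markov measure on $\partial\mathbb{F}_r$ whose stochastic matrix $P$ admits a positive stationary distribution and is weakly inverse-symmetric. Let $\tilde\mu=\sum_{n\ge1}2^{-n}(\gamma_n)_*\mu$, where $(\gamma_n)_{n\ge1}$ is an arbitrary enumeration of $\mathbb{F}_r$. Let $\beta$ denote the boundary action of $\mathbb{F}_r$ on $\partial\mathbb{F}_r$. Then the following are equivalent: (1) The boundary action $\mathbb{F}_r\curvearrowright^\beta(\partial\mathbb{F}_r,\mu)$ is weakly mixing. (2) The nonsingularization $\mathbb{F}_r\curvearrowright^\beta(\partial\mathbb{F}_r,\tilde\mu)$ is metrically ergodic. (3) The boundary action $\mathbb{F}_r\curvearrowright^\beta(\partial\mathbb{F}_r,\mu)$ is boundedly chaining. (4) The nonsingularization $\mathbb{F}_r\curvearrowright^\beta(\partial\mathbb{F}_r,\tilde\mu)$ is essentially $(|S|-1)$-chaining. (5) The boundary action $\mathbb{F}_r\curvearrowright^\beta(\partial\mathbb{F}_r,\mu)$ is $(|S|-1)$-chaining. (6) $P$ is strictly irreducible.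
   Context: $\mathbb{N}$ includes $0$. $\partial\mathbb{F}_r\subseteq S^{\mathbb{N}}$ is the closed set of infinite reduced words ($x_{i+1}\ne x_i^{-1}$ for all $i$); $\mathbb{F}_r$ acts on it by concatenation on the left followed by cancellation (the boundary action). Markov measure: given a row-stochastic matrix $P$ indexed by $S$ and a strictly positive probability distribution $\pi$ on $S$ (not assumed $P$-stationary), the induced Markov measure is the Borel probability measure $\mu$ on $S^{\mathbb{N}}$ with $\mu([w])=\pi(w_0)P(w_0,w_1)\cdots P(w_{n-2},w_{n-1})$ for every $w\in S^n$, $n\ge1$, where $[w]$ is the set of sequences extending $w$. A Markov measure on $\partial\mathbb{F}_r$ is one supported on $\partial\mathbb{F}_r$, i.e. $P(a,a^{-1})=0$ for all $a\in S$. A stationary distribution of $P$ is a probability vector $\pi'$ on $S$ with $\pi'P=\pi'$; it is positive if all entries are positive. $P$ is weakly inverse-symmetric if for all $a,b\in S$ with $b\neq a^{\pm1}$: $P(a,b)=0$ iff $P(a^i,b^j)=0$ for all $i,j\in\{1,-1\}$. A nonnegative matrix $Q$ on $S$ is irreducible if for all $a,b\in S$ there is $n\ge1$ with $Q^n(a,b)>0$. $P$ is strictly irreducible if both $P$ and $PP^t$ are irreducible (for irreducible $P$, irreducibility of $PP^t$ is equivalent to that of $P^tP$). The boundary action may be singular (not measure-class preserving) with respect to $\mu$; the following definitions apply to any Borel action of a countable group $\Gamma$ on a standard probability space $(X,\mu)$. Ergodic: every $\Gamma$-invariant $\mu$-measurable set is null or conull. Weakly mixing: for every ergodic probability measure preserving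 action of $\Gamma$ on a standard probability space $(Y,\nu)$, the diagonal action $\Gamma\curvearrowright(X\times Y,\mu\times\nu)$ is ergodic. Metrically ergodic: for every action $\Gamma\curvearrowright Z$ by isometries on a separable metric space $(Z,d)$, every $\mu$-measurable $\Gamma$-equivariant map $X\to Z$ is $\mu$-essentially constant. $A$ $k$-chains to $B$ if there are $\gamma_0=1_\Gamma,\gamma_1,\dots,\gamma_k\in\Gamma$ with $\mu(\gamma_iA\cap\gamma_{i+1}A)>0$ for $0\le i<k$ and $\mu(\gamma_kA\cap B)>0$. The action is $k$-chaining if $A$ $k$-chains to $B$ for all (Borel) sets $A,B\subseteq X$ of positive measure; it is boundedly chaining if it is $k$-chaining for some $k\in\mathbb{N}$. It is $k$-chaining on a measurable set $W\subseteq X$ if $A$ $k$-chains to $B$ for all (Borel) positive measure sets $A,B\subseteq W$ (the translates in the chain need not be contained in or meet $W$). It is essentially $k$-chaining if it is $k$-chaining on some measurable $W\subseteq X$ such that $\bigcup_{\gamma\in\Gamma}\gamma W$ is conull and $\{\gamma\in\Gamma:\mu(\gamma W\cap W)>0\}$ generates $\Gamma$. For the action on $(\partial\mathbb{F}_r,\tilde\mu)$, all these notions are taken with respect to $\tilde\mu$. *)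

(* Defs.v *)
From HB Require Import structures.
From mathcomp Require Import all_boot all_order all_algebra.
From mathcomp Require Import all_classical all_reals all_analysis.
Import Order.TTheory GRing.Theory Num.Theory.
Import numFieldNormedType.Exports.

Set Implicit Arguments.
Unset Strict Implicit.
Unset Printing Implicit Defensive.

Local Open Scope classical_set_scope.
Local Open Scope ring_scope.

(* The symmetric generating set S = {a_1^±1, ..., a_r^±1}: [lshift r i] is the
   i-th generator and [rshift r i] its inverse. *)
Notation letter r := 'I_(r + r).

Definition linv (r : nat) (a : letter r) : letter r :=
  match fintype.split a with inl i => rshift r i | inr i => lshift r i end.

Lemma linvK r : involutive (@linv r).
Proof.
move=> a; rewrite /linv; case: (split_ordP a) => i ->.
  by rewrite (unsplitK (inr i)).
by rewrite (unsplitK (inl i)).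
Qed.

Lemma linv_neq r (a : letter r) : linv a != a.
Proof.
rewrite /linv; case: (split_ordP a) => i ->.
  by rewrite eq_rlshift.
by rewrite eq_lrshift.
Qed.

(* [lpow a true] is a and [lpow a false] is a^-1. *)
Definition lpow (r : nat) (a : letter r) (e : bool) : letter r :=
  if e then a else linv a.

Section FreeGroup.
Variable r : nat.
Implicit Types (a b : letter r) (u v w : seq (letter r)).

Definition reduced w := sorted (fun a b => b != linv a) w.

(* The reduced form of a.w, for a reduced word w. *)
Definition red_cons a w :=
  if w is b :: w' then if b == linv a then w' else a :: w else [:: a].

Definition red_cat u v := foldr red_cons v u.

Definition word_inv w := rev [seq linv a | a <- w].

Lemma red_cons_reduced a w : reduced w -> reduced (red_cons a w).
Proof.
case: w => [//|b w] /= pw; case: ifPn => [_|ba]; last by rewrite /= ba.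
exact: path_sorted pw.
Qed.

Lemma red_cat_reduced u v : reduced v -> reduced (red_cat u v).
Proof. by move=> rv; elim: u => //= a u IH; exact: red_cons_reduced. Qed.

Lemma red_consK a w : reduced w -> red_cons a (red_cons (linv a) w) = w.
Proof.
case: w => [|b w] /=; first by rewrite eqxx.
rewrite linvK; case: eqP => [->|/eqP ba] pw; last by rewrite /= eqxx.
case: w pw => [//|c w] /= /andP[ca _].
by rewrite (negbTE ca).
Qed.

Lemma red_cat_cons a u w : reduced w ->
  red_cat (red_cons a u) w = red_cons a (red_cat u w).
Proof.
move=> rw; case: u => [//|b u] /=; case: ifP => [/eqP ->|//].
by rewrite red_consK// red_cat_reduced.
Qed.

Lemma red_catA u v w : reduced w ->
  red_cat u (red_cat v w) = red_cat (red_cat u v) w.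
Proof. by move=> rw; elim: u => [//|a u IH] /=; rewrite red_cat_cons// IH. Qed.

Lemma red_cat_nil u : reduced u -> red_cat u [::] = u.
Proof.
elim: u => [//|a u IH] /= ru; rewrite IH; last exact: path_sorted ru.
by case: u ru {IH} => [//|b u] /= /andP[/negbTE ->].
Qed.

Lemma red_cat_inv u : red_cat (word_inv u) u = [::].
Proof.
elim: u => [//|a u IH]; rewrite /word_inv /= rev_cons /red_cat foldr_rcons /=.
by rewrite linvK eqxx; exact: IH.
Qed.

Lemma word_invK : involutive word_inv.
Proof.
by move=> w; rewrite /word_inv map_rev revK -map_comp map_id_in// => a _ /=;
  rewrite linvK.
Qed.

Lemma word_inv_reduced w : reduced w -> reduced (word_inv w).
Proof.
rewrite /reduced /word_inv rev_sorted sorted_map; apply: sub_sorted => a b /=.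
by apply: contra_neq => /= h; rewrite -(linvK b) -h.
Qed.

Record free_group := FreeGroup { fword :> seq (letter r); _ : reduced fword }.

HB.instance Definition _ := [isSub for fword].
HB.instance Definition _ := [Countable of free_group by <:].

Lemma fword_reduced (g : free_group) : reduced g. Proof. by case: g. Qed.

Definition fone : free_group := @FreeGroup [::] isT.
Definition fmul (g h : free_group) : free_group :=
  FreeGroup (red_cat_reduced g (fword_reduced h)).
Definition finv (g : free_group) : free_group :=
  FreeGroup (word_inv_reduced (fword_reduced g)).

Lemma fmulA : associative fmul.
Proof. by move=> g h k; apply: val_inj; rewrite /= red_catA// fword_reduced. Qed.

Lemma fmul1 : left_id fone fmul. Proof. by move=> g; exact: val_inj. Qed.

Lemma fmulr1 : right_id fone fmul.
Proof. by move=> g; apply: val_inj; rewrite /= red_cat_nil// fword_reduced. Qed.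

Lemma fmulV : left_inverse fone finv fmul.
Proof. by move=> g; apply: val_inj; rewrite /= red_cat_inv. Qed.

Lemma fmulrV : right_inverse fone finv fmul.
Proof.
by move=> g; apply: val_inj; rewrite /= -{1}(word_invK g) red_cat_inv.
Qed.

HB.instance Definition _ :=
  isGroup.Build free_group fmulA fmul1 fmulr1 fmulV fmulrV.

End FreeGroup.

Section Boundary.
Variable r : nat.

Record boundary := Boundary {
  bseq :> nat -> letter r;
  bseqP : forall i, bseq i.+1 != linv (bseq i) }.

Lemma boundary_eq (x y : boundary) : bseq x =1 bseq y -> x = y.
Proof.
case: x y => [x xP] [y yP] /= /funext xy; subst y.
by congr Boundary; exact: Prop_irrelevance.
Qed.

HB.instance Definition _ := gen_eqMixin boundary.
HB.instance Definition _ := gen_choiceMixin boundary.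

(* The reduced form of the infinite word a.x, for x reduced. *)
Definition bcons_seq (a : letter r) (x : nat -> letter r) : nat -> letter r :=
  if x 0%N == linv a then fun i => x i.+1
  else fun i => if i is j.+1 then x j else a.

Lemma bcons_seqP a (x : boundary) i :
  bcons_seq a x i.+1 != linv (bcons_seq a x i).
Proof.
rewrite /bcons_seq; case: ifPn => xa; first exact: bseqP.
by case: i => [//|i]; exact: bseqP.
Qed.

Definition bcons a (x : boundary) : boundary := Boundary (bcons_seqP a x).

Definition bact (g : free_group r) (x : boundary) : boundary :=
  foldr bcons x (fword g).

Lemma bconsK a x : bcons a (bcons (linv a) x) = x.
Proof.
apply: boundary_eq => i; rewrite /= /bcons_seq linvK.
case: (eqVneq (x 0%N) a) => [xa|xa]; last by rewrite eqxx.
have := bseqP x 0; rewrite xa => /negbTE ->.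
by case: i.
Qed.

Lemma bact1 x : bact 1%g x = x. Proof. by []. Qed.

Lemma bactM g h x : bact (g * h)%g x = bact g (bact h x).
Proof.
rewrite /bact /=; elim: (fword g) => [//|a u /= <-].
case: (red_cat u (fword h)) => [//|b w] /=; case: ifP => // /eqP ->.
by rewrite bconsK.
Qed.

(* The trace on the boundary of [w_0 ... w_(n-1)]; only the first n values
   of w matter. *)
Definition cylinder (w : nat -> letter r) (n : nat) : set boundary :=
  [set x | forall i, (i < n)%N -> x i = w i].

Definition cylinders : set (set boundary) :=
  [set A | exists w n, A = cylinder w n].

End Boundary.

(* Measurable types are pointed, and the boundary of the free group of rank 0
   is empty: from here on the rank is r.+1. *)
Lemma boundary_pt_subproof r (i : nat) :
  (fun=> lshift r.+1 (@ord0 r)) i.+1 != linv ((fun=> lshift r.+1 (@ord0 r)) i).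
Proof. by rewrite eq_sym linv_neq. Qed.

HB.instance Definition _ r := isPointed.Build (boundary r.+1)
  (@Boundary r.+1 (fun=> lshift r.+1 (@ord0 r)) (@boundary_pt_subproof r)).

(* Borel sets of the boundary: the cylinders form a countable basis of the
   topology inherited from S^N. *)
HB.instance Definition _ r := @isMeasurable.Build
  (sigma_display (@cylinders r.+1)) (boundary r.+1) <<s @cylinders r.+1 >>
  (@sigma_algebra0 _ setT _) (@sigma_algebraC (boundary r.+1) _)
  (@sigma_algebra_bigcup _ setT _).

Lemma cylinder_measurable r (w : nat -> letter r.+1) n :
  measurable (cylinder w n).
Proof. by apply: sub_sigma_algebra; exists w, n. Qed.

Lemma bcons_measurable r (a : letter r.+1) :
  measurable_fun setT (@bcons r.+1 a).
Proof.
apply: (measurability (@cylinders r.+1)) => //.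
move=> _ [_ [w [n ->]] <-]; rewrite setTI.
pose w0 (i : nat) := if i is j.+1 then w j else linv a.
have -> : bcons a @^-1` cylinder w n = cylinder w0 n.+1 `|`
    (if (n == 0%N) || (a == w 0%N)
     then cylinder (fun i => w i.+1) n.-1 `\` cylinder w0 1 else set0).
  apply/seteqP; split=> x; rewrite /cylinder /= /bcons_seq.
    case: eqP => [xa h|xa h]; [left|right].
      by case=> [//|i] /=; rewrite ltnS => /h.
    have xa' : ~ forall i, (i < 1)%N -> x i = w0 i by move=> /(_ 0%N isT).
    case: n h => [|n] h /=; first by split.
    have -> : (a == w 0%N) by rewrite (h 0%N isT).
    by split=> // i i_n; rewrite -(h i.+1).
  case=> [h|].
    by rewrite (h 0%N)//= eqxx => i i_n; rewrite (h i.+1).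
  case: ifP => // /orP naw [] /= h xa; case: eqP => [xa0|_].
    by case: xa => -[|//] _.
  case: naw => [/eqP -> //|/eqP aw].
  by case=> [_ //|i] i_n; apply: h; rewrite -ltnS (ltn_predK i_n).
apply: measurableU; first exact: cylinder_measurable.
case: ifP => _ //.
by apply: measurableD; exact: cylinder_measurable.
Qed.

Lemma bact_measurable r (g : free_group r.+1) : measurable_fun setT (bact g).
Proof.
rewrite /bact; elim: (fword g) => [|a u IH] /=; first exact: measurable_id.
by apply: measurableT_comp => //; exact: bcons_measurable.
Qed.

Section MarkovChain.
Variable R : realType.

Definition row_stochastic n (P : 'M[R]_n) :=
  (forall a b, 0 <= P a b) /\ (forall a, \sum_b P a b = 1).

Definition probability_vector n (v : 'rV[R]_n) :=
  (forall a, 0 <= v 0 a) /\ \sum_a v 0 a = 1.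

Definition positive_vector n (v : 'rV[R]_n) := forall a, 0 < v 0 a.

Definition stationary_distribution n (P : 'M[R]_n) (v : 'rV[R]_n) :=
  probability_vector v /\ v *m P = v.

Definition mx_irreducible n (Q : 'M[R]_n) :=
  forall a b, exists k, (1 <= k)%N /\ 0 < (Q ^+ k) a b.

Definition strictly_irreducible n (P : 'M[R]_n) :=
  mx_irreducible P /\ mx_irreducible (P *m P^T).

Definition weakly_inverse_symmetric r (P : 'M[R]_(r + r)) :=
  forall a b : letter r, b != a -> b != linv a ->
    forall i j : bool, P a b = 0 <-> P (lpow a i) (lpow b j) = 0.

Definition markov_measure r (pi : 'rV[R]_(r.+1 + r.+1))
    (P : 'M[R]_(r.+1 + r.+1)) (mu : probability (boundary r.+1) R) :=
  [/\ row_stochastic P,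
      probability_vector pi,
      positive_vector pi,
      forall a, P a (linv a) = 0
    & forall (w : nat -> letter r.+1) (n : nat),
        mu (cylinder w n.+1) =
        (pi 0%R (w 0%N) * \prod_(i < n) P (w i) (w i.+1))%:E].

End MarkovChain.

Definition group_action (G : groupType) (X : Type) (a : G -> X -> X) :=
  (forall x, a 1%g x = x) /\ (forall g h x, a (g * h)%g x = a g (a h x)).

Record borel_action (G : groupType) d (X : measurableType d) := BorelAction {
  act_fun :> G -> X -> X;
  act_axiom : group_action act_fun;
  act_measurable : forall g, measurable_fun setT (act_fun g) }.

Lemma diag_group_action (G : groupType) d1 d2 (X : measurableType d1)
    (Y : measurableType d2) (a : borel_action G X) (b : borel_action G Y) :
  group_action (fun g (z : X * Y) => (a g z.1, b g z.2)).
Proof.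
have [[a1 aM] [b1 bM]] := (act_axiom a, act_axiom b).
by split=> [[x y]|g h [x y]] /=; rewrite ?a1 ?b1 ?aM ?bM.
Qed.

Lemma diag_measurable (G : groupType) d1 d2 (X : measurableType d1)
    (Y : measurableType d2) (a : borel_action G X) (b : borel_action G Y) g :
  measurable_fun setT (fun z : X * Y => (a g z.1, b g z.2)).
Proof.
apply: measurable_fun_pair.
  by apply: measurableT_comp => //; exact: act_measurable.
by apply: measurableT_comp => //; exact: act_measurable.
Qed.

Definition diagonal_action (G : groupType) d1 d2 (X : measurableType d1)
    (Y : measurableType d2) (a : borel_action G X) (b : borel_action G Y) :
    borel_action G (X * Y)%type :=
  BorelAction (diag_group_action a b) (diag_measurable a b).

Definition boundary_action (r : nat) :
    borel_action (free_group r.+1) (boundary r.+1) :=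
  BorelAction (conj (@bact1 r.+1) (@bactM r.+1)) (@bact_measurable r).

Section Nonsingularization.
Local Open Scope ereal_scope.
Variables (R : realType) (G : groupType) (d : measure_display).
Variables (X : measurableType d) (a : borel_action G X).
Variables (mu : probability X R) (gamma : nat -> G).

Definition translate (g : G) : set X -> \bar R := pushforward mu (a g).

Let act_preimage_measurable g (A : set X) :
  measurable A -> measurable (a g @^-1` A).
Proof.
by move=> mA; rewrite -[X in measurable X]setTI; exact: act_measurable.
Qed.

Let translate0 g : translate g set0 = 0.
Proof. by rewrite /translate /pushforward preimage_set0 measure0. Qed.

Let translate_ge0 g A : 0 <= translate g A.
Proof. by rewrite /translate /pushforward; exact: measure_ge0. Qed.

Let translate_sigma_additive g : semi_sigma_additive (translate g).
Proof.
move=> F mF tF mUF; rewrite /translate /pushforward preimage_bigcup.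
apply: measure_semi_sigma_additive.
- by move=> n; exact: act_preimage_measurable.
- apply/trivIsetP => /= i j _ _ ij; rewrite -preimage_setI.
  by move/trivIsetP : tF => /(_ _ _ _ _ ij) ->//; rewrite preimage_set0.
- by rewrite -preimage_bigcup; exact: act_preimage_measurable.
Qed.

HB.instance Definition _ g := isMeasure.Build _ _ _ (translate g)
  (translate0 g) (translate_ge0 g) (@translate_sigma_additive g).

(* The enumeration is indexed from 0, so gamma_n gets the weight 2^-(n+1). *)
Definition nonsingularization (A : set X) : \bar R :=
  \sum_(0 <= n <oo) ((2^-1 ^+ n.+1)%R)%:E * translate (gamma n) A.

Let weight n : {nonneg R} := ((2^-1 : R) ^+ n.+1)%:nng%R.

HB.instance Definition _ := Measure.copy nonsingularization
  (mseries (fun n => mscale (weight n) (translate (gamma n))) 0).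

Let nonsingularizationT : nonsingularization setT = 1.
Proof.
transitivity (limn (eseries (fun k => (1 / (2 ^ (k + 1))%:R : R)%R%:E))).
  congr (limn _); apply/funext => n; rewrite /eseries /=.
  apply: eq_bigr => i _.
  rewrite /translate /pushforward preimage_setT probability_setT mule1.
  by rewrite addn1 div1r natrX exprVn.
have := @cvg_geometric_eseries_half R 1 0; rewrite expr0 divr1.
exact: cvg_lim.
Qed.

HB.instance Definition _ :=
  Measure_isProbability.Build _ _ _ nonsingularization nonsingularizationT.

End Nonsingularization.

Section ErgodicNotions.
Local Open Scope ereal_scope.
Variable R : realType.

(* Measurability with respect to the completion of mu. *)
Definition mu_measurable d (X : measurableType d)
    (mu : {measure set X -> \bar R}) (A : set X) :=
  exists B, measurable B /\ mu.-negligible (A `+` B).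

Definition separable (T : topologicalType) :=
  exists D : set T, countable D /\ dense D.

Definition complete_metric (T : metricType R) :=
  forall F : set_system T, ProperFilter F -> cauchy F -> exists l : T, F --> l.

Definition borel_sets (T : topologicalType) : set (set T) := <<s @open T >>.

(* Y is Borel isomorphic to a Polish space T. *)
Definition standard_borel d (Y : measurableType d) :=
  exists (T : metricType R) (f : Y -> T),
    [/\ complete_metric T, separable T, bijective f
      & forall A : set Y, measurable A <-> borel_sets (f @` A)].

Variables (G : groupType) (d : measure_display) (X : measurableType d).
Implicit Types (a : borel_action G X) (mu : {measure set X -> \bar R}).

Definition measure_preserving a mu :=
  forall g (A : set X), measurable A -> mu (a g @^-1` A) = mu A.

(* mu need not be quasi-invariant, so the sets are invariant on the nose and
   not merely modulo null sets. *)
Definition ergodic a mu :=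
  forall A : set X, mu_measurable mu A -> (forall g, a g @` A = A) ->
    mu.-negligible A \/ mu.-negligible (~` A).

Definition metrically_ergodic a mu :=
  forall (Z : metricType R) (b : G -> Z -> Z),
    separable Z -> group_action b ->
    (forall g z1 z2, mdist (b g z1) (b g z2) = mdist z1 z2) ->
    forall f : X -> Z,
      (forall B, borel_sets B -> mu_measurable mu (f @^-1` B)) ->
      (forall g x, f (a g x) = b g (f x)) ->
      exists z, {ae mu, forall x, f x = z}.

Definition chains a mu (k : nat) (A B : set X) :=
  exists g : nat -> G,
    [/\ g 0%N = 1%g,
        forall i, (i < k)%N -> 0 < mu (a (g i) @` A `&` a (g i.+1) @` A)
      & 0 < mu (a (g k) @` A `&` B)].

Definition chaining_on a mu (k : nat) (W : set X) :=
  forall A B : set X, measurable A -> measurable B ->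
    A `<=` W -> B `<=` W -> 0 < mu A -> 0 < mu B -> chains a mu k A B.

Definition chaining a mu (k : nat) := chaining_on a mu k setT.

Definition boundedly_chaining a mu := exists k, chaining a mu k.

Definition generates (E : set G) :=
  forall H : {pred G}, group_closed H -> (forall g, E g -> g \in H) ->
    forall g, g \in H.

Definition essentially_chaining a mu (k : nat) :=
  exists W : set X,
    [/\ measurable W,
        chaining_on a mu k W,
        mu.-negligible (~` \bigcup_(g in [set: G]) a g @` W)
      & generates [set g | 0 < mu (a g @` W `&` W)]].

End ErgodicNotions.

Definition weakly_mixing (R : realType) (G : groupType) d
    (X : measurableType d) (a : borel_action G X) (mu : probability X R) :=
  forall d' (Y : measurableType d') (nu : probability Y R)
      (b : borel_action G Y),
    standard_borel R Y -> measure_preserving b nu -> ergodic b nu ->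
    ergodic (diagonal_action a b) (mu \x nu)%E.

(* Main.v *)
Require Import Defs.
From HB Require Import structures.
From mathcomp Require Import all_boot all_order all_algebra all_fingroup.
From mathcomp Require Import all_classical all_reals all_analysis.
From mathcomp Require Import ring lra.
Import Order.TTheory GRing.Theory Num.Theory.
Import numFieldNormedType.Exports.

(* Write N(a) for the set of letters b with P(a,b) > 0, and call a and b
   overlapping when N(a) and N(b) meet; as P has positive rows, P P^t is
   irreducible iff any two letters are joined by a chain of overlaps.

   If P is strictly irreducible and A has positive measure, then A nearly fills
   some cylinder whose last letter is any prescribed a (density, then spreading
   along the edges of P), so some translate of A nearly fills every cylinder
   [c] with c in N(a).  Such translates of A for overlapping letters meet in
   positive measure; a chain of overlaps from a predecessor of a first letter
   of A to a predecessor of a first letter of B thus chains A to B.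

   Bounded chaining makes every equivariant map to a space with an invariant
   pseudometric essentially constant, as soon as countably many balls of any
   given radius cover the image almost surely.  Applied to a metric space this
   is metric ergodicity; applied to the sections x |-> E_x of an invariant set
   of X * Y, with distance the measure of the symmetric difference, it is weak
   mixing.

   If P is not strictly irreducible, the boundary has an equivariant map to a
   finite set with two fibres of positive measure, which contradicts each of
   the other conditions.  When P is reducible the map tells whether the tail of
   x lies in a closed class of letters.  When P is irreducible, let t(c) be the
   overlap class of c and s(c) that of the predecessors of c; a generator c acts
   on the classes by the transposition of s(c) and t(c), and x is sent to
   x_0 ... x_(n-1) . s(x_n), which does not depend on n large: s(x_(n+1)) is the
   class t(x_n), which x_n moves to s(x_n). *)

Set Implicit Arguments.
Unset Strict Implicit.
Unset Printing Implicit Defensive.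

Local Open Scope classical_set_scope.
Local Open Scope ring_scope.

(** * Approximation of measurable sets by an algebra *)

Section Approximation.
Local Open Scope ereal_scope.
Variables (R : realType) (d : measure_display) (T : measurableType d).
Variable mu : probability T R.

Lemma measure_mono (A B : set T) : measurable A -> measurable B ->
  A `<=` B -> mu A <= mu B.
Proof. by move=> mA mB AB; apply: le_measure; rewrite ?inE. Qed.

Lemma measurableY (A B : set T) :
  measurable A -> measurable B -> measurable (A `+` B).
Proof. by move=> mA mB; apply: measurableU; exact: measurableD. Qed.

Definition approximable (G : set (set T)) (A : set T) :=
  forall e : R, (0 < e)%R -> exists2 D, G D & mu (A `+` D) < e%:E.

Variable G : set (set T).
Hypotheses (G0 : G set0) (GC : setC_closed G) (GU : setU_closed G).
Hypothesis mG : G `<=` measurable.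

Lemma approximable_mem A : G A -> approximable G A.
Proof. by move=> GA e e0; exists A; rewrite // setYK measure0 lte_fin. Qed.

Lemma approximableU A B : measurable A -> measurable B ->
  approximable G A -> approximable G B -> approximable G (A `|` B).
Proof.
move=> mA mB aA aB e e0; have e20 : (0 < e / 2)%R by rewrite divr_gt0.
have [D GD AD] := aA _ e20; have [E GE BE] := aB _ e20.
exists (D `|` E); first exact: GU.
rewrite (splitr e) EFinD; apply: le_lt_trans (lteD AD BE).
have [mD mE] := (mG GD, mG GE).
apply: le_trans (measureU2 _ _ _); try exact: measurableY.
apply: measure_mono.
- by apply: measurableY; exact: measurableU.
- by apply: measurableU; exact: measurableY.
- by move=> x [[[?|?] /not_orP[? ?]]|[[?|?] /not_orP[? ?]]];
    [left; left|right; left|left; right|right; right].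
Qed.

(** What the first n sets leave out of the union decreases to the empty set, so its mass tends to 0.
    Half of the error pays for that remainder, the other half for approximating a finite union. *)
Lemma approximable_bigcup (F : (set T)^nat) :
  (forall n, measurable (F n)) -> (forall n, approximable G (F n)) ->
  approximable G (\bigcup_n F n).
Proof.
move=> mF aF e e0; have e20 : (0 < e / 2)%R by rewrite divr_gt0.
pose U n := \big[setU/set0]_(i < n) F i.
have mU n : measurable (U n) by exact: bigsetU_measurable.
have aU n : approximable G (U n).
  elim: n => [|n IH]; first by rewrite /U big_ord0; exact: approximable_mem.
  by rewrite /U big_ord_recr /=; apply: approximableU => //; exact: mU.
have mFU : measurable (\bigcup_n F n) by exact: bigcup_measurable.
pose V n := \bigcup_n F n `\` U n.
have mV n : measurable (V n) by exact: measurableD.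
have V0 : \bigcap_n V n = set0.
  rewrite -subset0 => x xV; have [[n _ Fnx] _] := xV 0%N I.
  have [_] := xV n.+1 I; apply; rewrite /U -bigcup_mkord.
  by exists n => //=; rewrite ltnSn.
have : mu \o V @ \oo --> mu (\bigcap_n V n).
  apply: nonincreasing_cvg_mu => //; first by rewrite (le_lt_trans
    (probability_le1 _ (mV 0%N))) ?ltry.
    by rewrite V0.
  move=> m n mn; rewrite subsetEset; apply: setDS.
  by rewrite /U -!bigcup_mkord => x [i /= im Fx]; exists i;
    rewrite //= (leq_trans im).
have lt0e : 0 < (e / 2)%:E by rewrite lte_fin.
rewrite V0 measure0 => /(_ _ (open_ereal_lt' lt0e))[n _ /(_ n (leqnn n))] /= Vn.
have [D GD UD] := aU n _ e20.
exists D => //; have mD := mG GD.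
rewrite (splitr e) EFinD; apply: le_lt_trans (lteD Vn UD).
apply: le_trans (measureU2 _ _ _) => //; try exact: measurableY.
apply: measure_mono; try exact: measurableY.
  by apply: measurableU => //; exact: measurableY.
move=> x [[Fx Dx]|[Dx nFx]].
  by have [Ux|Ux] := pselect (U n x); [right; left|left; split].
right; right; split=> // Ux; apply: nFx.
by move: Ux; rewrite /U -bigcup_mkord => -[i _ Fi]; exists i.
Qed.

Lemma approximable_sigma_algebra A : <<s G >> A ->
  measurable A /\ approximable G A.
Proof.
apply: (@smallest_sub _ _ G [set A | measurable A /\ approximable G A]) => [|B
  GB]; last by split; [exact: mG|exact: approximable_mem].
split.
- by split => //; exact: approximable_mem.
- move=> B [mB aB]; split; first exact: measurableD.
  move=> e e0; have [D GD BD] := aB _ e0.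
  exists (~` D); first exact: GC.
  (* The symmetric difference does not change when both sets are complemented. *)
  by rewrite setTD -setYTC -(setYTC D) -setYA (setYC setT) -setYA setYK setY0.
- move=> F /all_and2[mF aF]; split; first exact: bigcup_measurable.
  exact: approximable_bigcup.
Qed.

End Approximation.

(** * Real-valued masses and countable unions *)

Section RealMeasure.
Variables (R : realType) (d : measure_display) (T : measurableType d).
Variable mu : probability T R.
Implicit Types A B : set T.

(** Masses as real numbers, so that inequalities between them are open to [lra] and [nra]. *)
Definition pr A : R := fine (mu A).

Lemma prE A : measurable A -> mu A = (pr A)%:E.
Proof. by move=> mA; rewrite /pr fineK// fin_num_measure. Qed.

Lemma pr_ge0 A : 0 <= pr A. Proof. exact: fine_ge0. Qed.

Lemma pr0 : pr set0 = 0. Proof. by rewrite /pr measure0. Qed.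

Lemma prT : pr setT = 1. Proof. by rewrite /pr probability_setT. Qed.

Lemma pr_gt0 A : measurable A -> (0 < mu A)%E = (0 < pr A).
Proof. by move=> mA; rewrite prE. Qed.

Lemma pr_mono A B : measurable A -> measurable B -> A `<=` B -> pr A <= pr B.
Proof. by move=> mA mB AB; rewrite -lee_fin -!prE//; exact: measure_mono. Qed.

Lemma pr_split A B : measurable A -> measurable B ->
  pr A = pr (A `\` B) + pr (A `&` B).
Proof.
move=> mA mB; have mD : measurable (A `\` B) by exact: measurableD.
have mI : measurable (A `&` B) by exact: measurableI.
by apply: EFin_inj; rewrite EFinD -!prE// -measureDI.
Qed.

Lemma pr_le1 A : measurable A -> pr A <= 1.
Proof. by move=> mA; rewrite -prT; exact: pr_mono. Qed.

Lemma prU_le A B : measurable A -> measurable B -> pr (A `|` B) <= pr A + pr B.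
Proof.
move=> mA mB; have mAB : measurable (A `|` B) by exact: measurableU.
by rewrite -lee_fin EFinD -!prE// measureU2.
Qed.

Lemma pr_setC A : measurable A -> pr (~` A) = 1 - pr A.
Proof.
move=> mA; have := pr_split measurableT mA; rewrite prT setTD setTI => ->.
by rewrite addrK.
Qed.

Lemma pr_bigcup0 (F : (set T)^nat) : (forall n, measurable (F n)) ->
  (forall n, pr (F n) = 0) -> pr (\bigcup_n F n) = 0.
Proof.
move=> mF F0; rewrite /pr measure_negligible//; first exact: bigcup_measurable.
apply: negligible_bigcup => n; apply/negligibleP => //.
by have : mu (F n) = 0%E by rewrite prE// F0.
Qed.

Lemma pr_sub0 A B : measurable A -> measurable B -> A `<=` B ->
  pr B = 0 -> pr A = 0.
Proof.
move=> mA mB AB B0; apply/eqP; rewrite eq_le pr_ge0 andbT -B0.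
exact: pr_mono.
Qed.

Lemma bigcup_unpickle (I : countType) (F : I -> set T) :
  \bigcup_i F i = \bigcup_n oapp F set0 (unpickle n).
Proof.
apply/seteqP; split=> [x [i _ Fx]|x [n _]]; first by exists (pickle i);
  rewrite // pickleK.
by case: (unpickle n) => //= i Fx; exists i.
Qed.

Lemma measurable_bigcup_count (I : countType) (F : I -> set T) :
  (forall i, measurable (F i)) -> measurable (\bigcup_i F i).
Proof.
move=> mF; rewrite bigcup_unpickle; apply: bigcup_measurable => n _.
by case: unpickle => /=.
Qed.

Lemma pr_bigcup_count0 (I : countType) (F : I -> set T) :
  (forall i, measurable (F i)) -> (forall i, pr (F i) = 0) ->
  pr (\bigcup_i F i) = 0.
Proof.
move=> mF F0; rewrite bigcup_unpickle; apply: pr_bigcup0 => n;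
  case: unpickle => //=.
exact: pr0.
Qed.

Lemma pr_partition (I : finType) (f : T -> I) A :
  (forall i, measurable (f @^-1` [set i])) -> measurable A ->
  pr A = \sum_i pr (A `&` f @^-1` [set i]).
Proof.
move=> mf mA; rewrite -big_enum /=.
have mfs (s : seq I) : measurable [set x | f x \in s].
  have -> : [set x | f x \in s] = \bigcup_(i in [set` s]) (f @^-1` [set i]).
    by apply/seteqP; split=> [x xs|x [i /= si fi]];
      [exists (f x)|rewrite /= fi].
  by apply: fin_bigcup_measurable.
suff H (s : seq I) : uniq s ->
    \sum_(i <- s) pr (A `&` f @^-1` [set i]) = pr (A `&` [set x | f x \in s]).
  rewrite H ?enum_uniq//; congr pr; apply/esym/setIidPl => x _ /=.
  by rewrite mem_enum.
elim: s => [_|i s IH /= /andP[nis us]].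
  by rewrite big_nil -[LHS]pr0; congr pr; apply/esym; rewrite -subset0 => x [].
rewrite big_cons IH// addrC [RHS](@pr_split _ (f @^-1` [set i]))//; last first.
  exact: measurableI.
congr (_ + _); congr pr; apply/seteqP; split=> x /=.
- by move=> [Ax xs]; split; [split=> //; rewrite inE xs orbT|move=> e;
  rewrite -e xs in nis].
- by move=> [[Ax]]; rewrite inE => /predU1P[].
- by move=> [Ax ->]; split=> //; split=> //; rewrite inE eqxx.
- by move=> [[Ax _] ->].
Qed.

Lemma pr_eq0 A : measurable A -> pr A = 0 <-> mu.-negligible A.
Proof.
move=> mA; split=> [A0|nA]; last by rewrite /pr measure_negligible.
apply/negligibleP => //; by have : mu A = 0%E by rewrite prE// A0.
Qed.

End RealMeasure.

Section ActionImage.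
Variables (G : groupType) (d : measure_display) (X : measurableType d).
Variable a : borel_action G X.

Lemma actVK g x : a g^-1%g (a g x) = x.
Proof. by have [a1 aM] := act_axiom a; rewrite -aM mulVg a1. Qed.

Lemma actKV g x : a g (a g^-1%g x) = x.
Proof. by have [a1 aM] := act_axiom a; rewrite -aM mulgV a1. Qed.

Lemma act_image g (A : set X) : a g @` A = a g^-1%g @^-1` A.
Proof.
apply/seteqP; split=> [_ [x Ax <-]|x Ax] /=; first by rewrite actVK.
by exists (a g^-1%g x); rewrite ?actKV.
Qed.

Lemma act_preimage_measurable g (A : set X) :
  measurable A -> measurable (a g @^-1` A).
Proof.
by move=> mA; rewrite -[X in measurable X]setTI; exact: act_measurable.
Qed.

Lemma act_image_measurable g (A : set X) :
  measurable A -> measurable (a g @` A).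
Proof. by move=> mA; rewrite act_image; exact: act_preimage_measurable. Qed.

End ActionImage.

(** * Words and cylinders *)

Section Words.
Variable r : nat.
Local Notation letter := (letter r.+1).
Local Notation X := (boundary r.+1).
Implicit Types (a b c : letter) (u w : seq letter) (x y : X).

Lemma bshift_subproof x i : x i.+2 != linv (x i.+1).
Proof. exact: bseqP. Qed.

Definition bshift x : X := Boundary (bshift_subproof x).

Lemma bcons_cons a x i : x 0%N != linv a ->
  bcons a x i = if i is j.+1 then x j else a.
Proof. by move=> xa; rewrite /= /bcons_seq (negbTE xa). Qed.

Lemma bshift_bcons a x : x 0%N != linv a -> bshift (bcons a x) = x.
Proof. by move=> xa; apply: boundary_eq => i; exact: (bcons_cons i.+1 xa). Qed.

Lemma bcons_shift a x : x 0%N = a -> bcons (linv a) x = bshift x.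
Proof.
by move=> xa; apply: boundary_eq => i; rewrite /= /bcons_seq linvK xa eqxx.
Qed.

Lemma bcons_bshift x : bcons (x 0%N) (bshift x) = x.
Proof.
by apply: boundary_eq => -[|i]; rewrite bcons_cons// bseqP.
Qed.

(** The recursion through the shift runs parallel to that of [path_weight]; [cylE] relates it to
    [cylinder]. *)
Fixpoint cyl u : set X :=
  if u is a :: u' then [set x : X | x 0%N = a /\ cyl u' (bshift x)] else setT.

Let c0 : letter := lshift r.+1 ord0.

Lemma cylE u : cyl u = cylinder (nth c0 u) (size u).
Proof.
apply/seteqP; split; elim: u => //= a u IH x.
  by case=> xa /IH ux [|i] //= i_u; exact: (ux i).
move=> ux; split; first exact: (ux 0%N).
by apply: IH => i i_u; exact: (ux i.+1).
Qed.

Lemma measurable_cyl u : measurable (cyl u).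
Proof. by rewrite cylE; exact: cylinder_measurable. Qed.

Lemma cylinder_cyl (w : nat -> letter) n : cylinder w n = cyl (mkseq w n).
Proof.
rewrite cylE size_mkseq; apply/seteqP; split=> x xw i i_n;
  by have := xw i i_n; rewrite nth_mkseq.
Qed.

Lemma cyl_mkseq x n : cyl (mkseq x n) x.
Proof. by rewrite -cylinder_cyl. Qed.

Lemma cyl1 a x : cyl [:: a] x <-> x 0%N = a.
Proof. by split=> [[]|]. Qed.

Lemma cyl_sub_cat u w : cyl (u ++ w) `<=` cyl u.
Proof. by elim: u => //= a u IH x [? /IH]. Qed.

Definition fgen a : free_group r.+1 := @FreeGroup _ [:: a] isT.

(** Defined on all words, so that inductions need not carry reducedness; [gwordE] recovers a group
    element from its reduced word. *)
Definition gword u : free_group r.+1 := foldr (fun a g => (fgen a * g)%g) 1%g u.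

Local Notation beta := (boundary_action r).

Lemma gwordE (g : free_group r.+1) : gword g = g.
Proof.
case: g => w rw; apply: val_inj => /=.
elim: w rw => //= a w IH rw.
rewrite IH; last exact: path_sorted rw.
by case: w rw {IH} => //= b w /andP[/negbTE ->].
Qed.

Lemma beta_gen a x : beta (fgen a) x = bcons a x. Proof. by []. Qed.

Lemma beta_gword_cons a u x : beta (gword (a :: u)) x = bcons a (beta (gword u)
  x).
Proof. by rewrite /= bactM. Qed.

Lemma beta_gen_image a u : linv a != head a u -> u != [::] ->
  beta (fgen a) @` cyl u = cyl (a :: u).
Proof.
case: u => [//|b u] ab _; apply/seteqP; split.
  move=> _ [x [xb ux] <-]; have xa : x 0%N != linv a by rewrite xb eq_sym.
  by rewrite beta_gen; split; rewrite ?bcons_cons// bshift_bcons.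
move=> x [xa [xb ux]]; exists (bshift x); first by split.
by rewrite beta_gen -xa bcons_bshift.
Qed.

(** Nothing cancels when [rcons u c] is reduced, so the letters of [u] are simply put in front one
    by one. *)
Lemma beta_gword_image u c w : reduced (rcons u c) ->
  beta (gword u) @` cyl (c :: w) = cyl (u ++ c :: w).
Proof.
elim: u => [_|a u IH].
  by apply/seteqP; split=> [_ [x cx <-]|x cx] //; exists x.
move=> pu; have ru : reduced (rcons u c) by exact: path_sorted pu.
rewrite cat_cons -(@beta_gen_image a (u ++ c :: w)).
- rewrite -IH//; apply/seteqP; split=> [_ [x cx <-]|_ [_ [x cx <-] <-]].
    by exists (beta (gword u) x); [exists x|rewrite beta_gword_cons].
  by exists x; rewrite // beta_gword_cons.
- by case: (u) pu => [|b v] /= /andP[]; rewrite eq_sym.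
- by case: (u).
Qed.

(** The empty set stands for the intersection of two disjoint cylinders, so that the generators
    visibly form a pi-system. *)
Lemma measurable_cylinders :
  (measurable : set (set X)) = <<s [set A | A = set0 \/ exists u, A = cyl u] >>.
Proof.
apply/seteqP; split; apply: smallest_sub; try exact: smallest_sigma_algebra.
- by move=> _ [w [n ->]]; rewrite cylinder_cyl; apply: sub_sigma_algebra;
  right; exists (mkseq w n).
- by move=> A [->|[u ->]]; [exact: measurable0|exact: measurable_cyl].
Qed.

Lemma cylI_closed : setI_closed [set A | A = set0 \/ exists u, A = cyl u].
Proof.
move=> A B [->|[u ->]]; first by rewrite set0I; left.
case=> [->|[w ->]]; first by rewrite setI0; left.
elim: u w => [|a u IH] w; first by rewrite setTI; right; exists w.
case: w => [|b w]; first by rewrite setIT; right; exists (a :: u).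
have [<-|ab] := eqVneq a b; last first.
  by left; rewrite -subset0 => x /= [[-> _] [e _]]; rewrite e eqxx in ab.
have [uw|[v uw]] := IH w.
  left; rewrite -subset0 => x /= [[_ ux] [_ wx]].
  by have : (cyl u `&` cyl w) (bshift x) by []; rewrite uw.
right; exists (a :: v); apply/seteqP; split=> x /=; rewrite -uw.
  by move=> [[-> ?] [_ ?]].
by move=> [-> []].
Qed.

End Words.

(** * Scaling of Markov measures under translation *)

Section Markov.
Variables (R : realType) (r : nat).
Local Notation letter := (letter r.+1).
Local Notation X := (boundary r.+1).
Local Notation beta := (boundary_action r).
Variables (pi : 'rV[R]_(r.+1 + r.+1)) (P : 'M[R]_(r.+1 + r.+1)).
Variable mu : probability X R.
Hypothesis mkv : markov_measure pi P mu.
Implicit Types (a b c : letter) (u w : seq letter) (x y : X) (A B E : set X).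
Local Notation m := (pr mu).

Lemma P_ge0 a b : 0 <= P a b. Proof. by case: mkv => -[]. Qed.

Lemma P_sum a : \sum_b P a b = 1. Proof. by case: mkv => -[]. Qed.

Lemma init_gt0 a : 0 < pi 0 a. Proof. by case: mkv. Qed.

Lemma P_linv a : P a (linv a) = 0. Proof. by case: mkv. Qed.

Definition edge : rel letter := fun a b => 0 < P a b.

Lemma edgePn a b : ~~ edge a b -> P a b = 0.
Proof. by rewrite /edge lt_neqAle P_ge0 andbT negbK => /eqP <-. Qed.

Lemma edge_neq a b : edge a b -> b != linv a.
Proof. by rewrite /edge; case: eqP => // ->; rewrite P_linv ltxx. Qed.

Lemma edge_reduced u : sorted edge u -> reduced u.
Proof. by apply: sub_sorted => a b; exact: edge_neq. Qed.

Lemma ex_edge a : exists b, edge a b.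
Proof.
apply/existsP; apply: contraT => /existsPn h.
have := P_sum a; rewrite big1 => [/esym/eqP|b _]; first by rewrite oner_eq0.
exact/edgePn/h.
Qed.

Fixpoint path_weight a u : R :=
  if u is b :: u' then P a b * path_weight b u' else 1.

Lemma pr_cyl a u : m (cyl (a :: u)) = pi 0 a * path_weight a u.
Proof.
rewrite /pr cylE; case: mkv => _ _ _ _ -> /=; congr (_ * _).
elim: u a => [|b u IH] a; first by rewrite big_ord0.
by rewrite big_ord_recl /= -IH.
Qed.

Lemma path_weight_gt0 a u : (0 < path_weight a u) = path edge a u.
Proof.
elim: u a => [|b u IH] a /=; first exact: ltr01.
have [ab|/edgePn ->] := boolP (edge a b); first by rewrite pmulr_rgt0.
by rewrite mul0r ltxx.
Qed.

Lemma path_weight_cat a u w :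
  path_weight a (u ++ w) = path_weight a u * path_weight (last a u) w.
Proof.
by elim: u a => [|b u IH] a /=; rewrite ?mul1r// IH mulrA.
Qed.

Lemma pr_cyl_gt0 u : sorted edge u -> 0 < m (cyl u).
Proof.
case: u => [_|a u au]; first by rewrite prT.
by rewrite pr_cyl mulr_gt0 ?init_gt0 ?path_weight_gt0.
Qed.

(** Putting [a] in front of a word that starts with [c] replaces the factor pi(c) in the mass of its
    cylinder by pi(a) P(a,c). Hence on [c] the translated measure and a multiple of [mu] agree on
    cylinders, and so on all Borel sets. *)
Lemma pr_scale1 a c E : c != linv a -> measurable E -> E `<=` cyl [:: c] ->
  m (beta (fgen a) @` E) * pi 0 c = pi 0 a * P a c * m E.
Proof.
move=> ca mE Ec.
have k0 : 0 <= pi 0 a * P a c / pi 0 c.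
  by rewrite divr_ge0 ?mulr_ge0 ?P_ge0// ltW ?init_gt0.
have mC : measurable (cyl [:: c]) by exact: measurable_cyl.
pose m1 : {measure set X -> \bar R} := mrestr (translate beta mu (fgen a)^-1%g)
  mC.
pose m2 : {measure set X -> \bar R} := mscale (NngNum k0) (mrestr mu mC).
have EE : E `&` cyl [:: c] = E by apply/setIidPl.
have m1E : m1 E = (m (beta (fgen a) @` E))%:E.
  rewrite /m1 /= /mrestr EE /translate /pushforward -act_image prE//.
  exact: act_image_measurable.
have m2E : m2 E = (pi 0 a * P a c / pi 0 c * m E)%:E.
  by rewrite /m2 /= /mscale /= /mrestr EE prE// EFinM.
suff : m1 E = m2 E.
  rewrite m1E m2E => -[->]; rewrite mulrAC divfK//.
  by rewrite gt_eqF ?init_gt0.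
apply: (measure_unique _ (fun=> setT) (measurable_cylinders r) (@cylI_closed
  r)) => //.
- by move=> i; right; exists [::].
- by rewrite bigcup_const//; exists 0%N.
- move=> A [->|[u ->]]; first by rewrite !measure0.
  have : cyl u `&` cyl [:: c] = set0 \/ exists v, cyl u `&` cyl [:: c] = cyl (c
    :: v).
    case: u => [|b u]; first by right; exists [::]; rewrite setTI.
    have [<-|bc] := eqVneq b c; last first.
      by left; rewrite -subset0 => x /= [[-> _] [e _]]; rewrite e eqxx in bc.
    by right; exists u; apply/setIidPl => x [].
  have -> : m1 (cyl u) = mu (beta (fgen a)^-1%g @^-1` (cyl u `&` cyl [:: c]))
    by [].
  have -> : m2 (cyl u) =
    ((pi 0 a * P a c / pi 0 c)%:E * mu (cyl u `&` cyl [:: c]))%E by [].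
  case=> [->|[v ->]]; first by rewrite preimage_set0 measure0 mule0.
  rewrite -act_image beta_gen_image//; last by rewrite eq_sym.
  rewrite !prE; try exact: measurable_cyl.
  rewrite -EFinM !pr_cyl /=; congr (_%:E); field.
  by rewrite gt_eqF ?init_gt0.
- move=> k; apply: le_lt_trans (probability_le1 mu _) (ltry 1).
  by apply: act_preimage_measurable; exact: measurableI.
Qed.

(** Induction on [u]: if b is the first letter of [rcons u c], the factor pi(b) on both sides of the
    one-letter identity cancels. *)
Lemma pr_scale u c E : reduced (rcons u c) -> measurable E -> E `<=` cyl [:: c]
  ->
  m (beta (gword u) @` E) * pi 0 c = m (cyl (rcons u c)) * m E.
Proof.
move=> + mE Ec; elim: u => [_|a u IH ru].
  rewrite [rcons _ _]/= pr_cyl [path_weight _ _]/= mulr1 mulrC; congr (_ * m _).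
  by apply/seteqP; split=> [_ [x Ex <-]|x Ex] //; exists x.
have ru' : reduced (rcons u c) by exact: path_sorted ru.
have [b [v uc]] : exists b v, rcons u c = b :: v.
  by case: (u) => [|b v]; [exists c, [::]|exists b, (rcons v c)].
have ab : b != linv a by move: ru; rewrite /reduced rcons_cons uc /= => /andP[].
have -> : beta (gword (a :: u)) @` E = beta (fgen a) @` (beta (gword u) @` E).
  apply/seteqP; split=> [_ [x Ex <-]|_ [_ [x Ex <-] <-]].
    by exists (beta (gword u) x); [exists x|rewrite beta_gword_cons].
  by exists x; rewrite // beta_gword_cons.
have Eb : beta (gword u) @` E `<=` cyl [:: b].
  apply: (@subset_trans _ (cyl (rcons u c))); last first.
    by rewrite uc => x [xb _].
  rewrite -cats1 -beta_gword_image// => _ [x Ex <-]; exists x => //; exact: Ec.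
have := pr_scale1 ab (act_image_measurable beta (gword u) mE) Eb.
have := IH ru'; rewrite rcons_cons uc !pr_cyl /= => h1 h2.
have pb := init_gt0 b; apply: (mulIf (lt0r_neq0 pb)).
by rewrite mulrAC h2 -[LHS]mulrA h1; ring.
Qed.

(** For a Markov measure with matrix [P] this is the support: it has full mass, and every cylinder
    that meets it has positive mass. *)
Definition admissible : set X := [set x | forall i, edge (x i) (x i.+1)].

(** A forbidden step already shows in a finite prefix. The complement is thus a countable union of
    cylinders, which are null by [pr_cyl_eq0]. *)
Lemma setC_admissible :
  ~` admissible = \bigcup_u (if sorted edge u then set0 else cyl u).
Proof.
apply/seteqP; split=> [x|x [u _]].
  move=> /existsNP[i xi]; exists (mkseq x i.+2) => //.
  case: ifP => [|_]; last exact: cyl_mkseq.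
  move=> /(sortedP (x 0%N)) /(_ i); rewrite size_mkseq ltnSn => /(_ isT).
  by rewrite !nth_mkseq// => xii; case: xi.
case: ifPn => // nsu ux xP; case/negP: nsu; move: ux.
case: u => // a u; elim: u a x xP => //= b u IH a x xP [xa [xb ux]].
by rewrite (IH b (bshift x) (fun i => xP i.+1))// -xb -xa xP.
Qed.

Lemma measurable_admissible : measurable admissible.
Proof.
rewrite -[X in measurable X]setCK; apply: measurableC; rewrite setC_admissible.
by apply: measurable_bigcup_count => u; case: ifP => _ //;
  exact: measurable_cyl.
Qed.

Lemma path_weight_ge0 a u : 0 <= path_weight a u.
Proof. by elim: u a => [|b u IH] a //=; rewrite mulr_ge0 ?P_ge0. Qed.

Lemma pr_cyl_eq0 u : ~~ sorted edge u -> m (cyl u) = 0.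
Proof.
case: u => // a u; rewrite /= -path_weight_gt0 lt_neqAle path_weight_ge0 andbT.
by rewrite negbK pr_cyl => /eqP <-; rewrite mulr0.
Qed.

Lemma pr_admissible : m admissible = 1.
Proof.
apply/eqP; rewrite eq_sym -subr_eq0 -pr_setC; last exact: measurable_admissible.
rewrite setC_admissible; apply/eqP/pr_bigcup_count0 => u.
  by case: ifP => _ //; exact: measurable_cyl.
by case: ifPn => [_|/pr_cyl_eq0 //]; rewrite pr0.
Qed.

End Markov.

(** * Sets that depend on finitely many letters *)

Section Determined.
Variables (R : realType) (r : nat).
Local Notation letter := (letter r.+1).
Local Notation X := (boundary r.+1).
Implicit Types (A B D : set X) (x y : X).

Definition determined n D := forall x y, mkseq x n = mkseq y n -> D x -> D y.

Lemma cylP u x : cyl u x <-> mkseq x (size u) = u.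
Proof.
split; last by move=> <-; exact: cyl_mkseq.
rewrite cylE => ux; apply: (@eq_from_nth _ (lshift r.+1 ord0)).
  by rewrite size_mkseq.
by move=> i; rewrite size_mkseq => i_u; rewrite nth_mkseq// ux.
Qed.

Lemma mkseq_coord n i x y : mkseq x n = mkseq y n -> (i < n)%N -> x i = y i.
Proof.
by move=> /(congr1 (nth (x i) ^~ i)) + i_n; rewrite !nth_mkseq.
Qed.

Lemma mkseq_leq n k x y : (n <= k)%N -> mkseq x k = mkseq y k ->
  mkseq x n = mkseq y n.
Proof.
move=> nk /(congr1 (take n)); rewrite /mkseq -!map_take take_iota.
by rewrite (minn_idPl nk).
Qed.

Lemma determined_leq n k D : (n <= k)%N -> determined n D -> determined k D.
Proof. by move=> nk dD x y /(mkseq_leq nk); exact: dD. Qed.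

Definition prefix n x : n.-tuple letter := [tuple of mkseq x n].

Lemma prefix_cyl n (t : n.-tuple letter) : @prefix n @^-1` [set t] = cyl t.
Proof.
apply/seteqP; split=> x /=.
  by move=> <-; exact: cyl_mkseq.
by move=> /cylP; rewrite size_tuple => e; apply: val_inj.
Qed.

Lemma measurable_prefix n (t : n.-tuple letter) : measurable (@prefix n @^-1`
  [set t]).
Proof. by rewrite prefix_cyl; exact: measurable_cyl. Qed.

Lemma measurable_determined n D : determined n D -> measurable D.
Proof.
move=> dD; have -> : D = \bigcup_(t in @prefix n @` D) cyl t.
  apply/seteqP; split=> [x Dx|x [_ [y Dy <-]]].
    by exists (prefix n x); [exists x|exact: cyl_mkseq].
  by move=> /cylP; rewrite size_tuple => /esym; move/dD; exact.
by apply: fin_bigcup_measurable => // t _; exact: measurable_cyl.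
Qed.

Lemma pr_prefix (mu : probability X R) n A : measurable A ->
  pr mu A = \sum_(t : n.-tuple letter) pr mu (A `&` cyl t).
Proof.
move=> mA; rewrite (pr_partition mu (@measurable_prefix n) mA).
by apply: eq_bigr => t _; rewrite prefix_cyl.
Qed.

Lemma determined_approx (mu : probability X R) A e : measurable A -> 0 < e ->
  exists n D, determined n D /\ pr mu (A `+` D) < e.
Proof.
move=> mA e0; pose G := [set D | exists n, determined n D].
have [||||| _ aA] := @approximable_sigma_algebra R _ X mu G _ _ _ _ A.
- by exists 0%N.
- move=> D [n dD]; exists n => x y xy nDx Dy; apply: nDx.
  exact: (dD y x (esym xy)).
- move=> D E [n dD] [k dE]; exists (maxn n k) => x y xy.
  by case=> [Dx|Ex]; [left|right]; move: xy;
    [move/(mkseq_leq (leq_maxl n k))|move/(mkseq_leq (leq_maxr n k))] => xy;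
    [exact: dD xy Dx|exact: dE xy Ex].
- by move=> D [n /measurable_determined].
- move: A mA; apply: smallest_sub; first exact: smallest_sigma_algebra.
  move=> _ [w [n ->]]; apply: sub_sigma_algebra; exists n => x y xy xw i i_n.
  by rewrite -(xw i i_n) (mkseq_coord xy i_n).
have [D [n dD] AD] := aA e e0.
exists n, D; split=> //; rewrite -lte_fin -prE//; apply: measurableY => //.
exact: measurable_determined dD.
Qed.

End Determined.

(** * Strict irreducibility and chaining *)

Section NonnegativeMatrix.
Variables (R : realType) (n : nat) (Q : 'M[R]_n).
Hypothesis Q0 : forall a b, 0 <= Q a b.

Let pos : rel 'I_n := fun a b => 0 < Q a b.

Lemma mx_pow_ge0 k a b : 0 <= (Q ^+ k) a b.
Proof.
elim: k a b => [|k IH] a b; first by rewrite expr0 mxE; case: (a == b).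
by rewrite exprS mxE sumr_ge0// => c _; rewrite mulr_ge0.
Qed.

Lemma mx_powS_gt0 k a b :
  0 < (Q ^+ k.+1) a b <-> exists2 c, pos a c & 0 < (Q ^+ k) c b.
Proof.
rewrite exprS mxE; split=> [|[c ac cb]]; last first.
  rewrite (bigD1 c)//= ltr_pwDl ?mulr_gt0// sumr_ge0// => d _.
  by rewrite mulr_ge0 ?mx_pow_ge0.
apply: contraPP => h; apply/negP; rewrite -leNgt sumr_le0// => c _.
rewrite leNgt; apply/negP => acb; apply: h.
move: acb; rewrite lt0r mulf_eq0 negb_or => /andP[/andP[ac cb] _].
by exists c; rewrite /pos lt_neqAle eq_sym ?ac ?cb/= ?mx_pow_ge0.
Qed.

Lemma mx_pow_connect a b : (exists k, 0 < (Q ^+ k) a b) <-> connect pos a b.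
Proof.
split=> [[k]|/connectP[p pp ->]].
  elim: k a => [|k IH] a.
    by rewrite expr0 mxE; case: eqP => [->//|_]; rewrite ltxx.
  move=> /mx_powS_gt0[c ac cb].
  exact: connect_trans (connect1 ac) (IH _ cb).
elim: p a pp => [|c p IH] a /=; first by exists 0%N; rewrite expr0 mxE eqxx.
by move=> /andP[ac /IH[k cb]]; exists k.+1; apply/mx_powS_gt0; exists c.
Qed.

(** [connect] is reflexive, whereas irreducibility asks for a path of length at least one; hence the
    separate first edge. *)
Lemma mx_irreducibleP :
  mx_irreducible Q <-> forall a b, exists2 c, pos a c & connect pos c b.
Proof.
split=> h a b.
  have [[|k] [// _ /(mx_powS_gt0 k a b).1 [c ac cb]]] := h a b.
  by exists c => //; apply/mx_pow_connect; exists k.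
have [c ac /mx_pow_connect[k cb]] := h a b.
by exists k.+1; split=> //; apply/mx_powS_gt0; exists c.
Qed.

End NonnegativeMatrix.

Lemma pos_lower_bound (R : realType) (I : finType) (f : I -> R) :
  (forall i, 0 < f i) -> exists2 e, 0 < e & forall i, e <= f i.
Proof.
move=> f0; exists (\big[Order.min/1]_i f i).
  by apply: lt_bigmin => //; exact: ltr01.
by move=> i; exact: bigmin_le.
Qed.

(** * Density of a set in cylinders *)

Section StrictlyIrreducible.
Variables (R : realType) (r : nat).
Local Notation letter := (letter r.+1).
Local Notation X := (boundary r.+1).
Local Notation beta := (boundary_action r).
Variables (pi : 'rV[R]_(r.+1 + r.+1)) (P : 'M[R]_(r.+1 + r.+1)).
Variable mu : probability X R.
Hypothesis mkv : markov_measure pi P mu.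
Implicit Types (a b c : letter) (u w : seq letter) (x y : X) (A B E : set X).
Local Notation m := (pr mu).
Local Notation edge := (edge P).

(** Relative density in cylinders that end with [b]. The strict inequality forces the cylinder to
    have positive mass. *)
Definition dense_after A b := forall e, 0 < e ->
  exists u, m (cyl (rcons u b) `\` A) < e * m (cyl (rcons u b)).

(** If no letter worked, [A] would miss a fixed share e of the cylinder of every nonempty word,
    hence of every finitely determined set. But a determined set close to [A] lies almost entirely
    inside [A]. *)
Lemma ex_dense_after A : measurable A -> 0 < m A -> exists b, dense_after A b.
Proof.
move=> mA A0; apply: contrapT => /forallNP nd.
have /choice[f fP] : forall b, exists e, 0 < e /\
    forall u, e * m (cyl (rcons u b)) <= m (cyl (rcons u b) `\` A).
  move=> b; have /existsNP[e /not_implyP[e0 /forallNP ne]] := nd b.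
  by exists e; split=> // u; rewrite leNgt; apply/negP/ne.
have [e e0 ef] := pos_lower_bound (fun b => (fP b).1).
have small (D : set X) n : determined n D -> e * m D <= m (D `\` A).
  (* Words of length n+1 are nonempty, so each has a last letter to which the bound applies. *)
  move=> /(determined_leq (leqnSn n)) dD.
  have mD := measurable_determined dD.
  rewrite (pr_prefix mu n.+1 mD) (pr_prefix mu n.+1 (measurableD mD mA)).
  rewrite mulr_sumr; apply: ler_sum => t _.
  have [Dt|Dt] := pselect (exists2 x, D x & mkseq x n.+1 = t); last first.
    rewrite [X in m X](_ : _ = set0) ?pr0 ?mulr0 ?pr_ge0//.
    rewrite -subset0 => x [Dx /cylP]; rewrite size_tuple => xt.
    by apply: Dt; exists x.
  have tD : cyl t `<=` D.
    move=> x /cylP; rewrite size_tuple => xt.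
    by have [y Dy yt] := Dt; apply: dD Dy; rewrite xt yt.
  rewrite setDE setIAC (setIidr tD) -setDE.
  case: t {Dt tD} => t; case/lastP: t => //= u b _.
  exact: le_trans (ler_wpM2r (pr_ge0 _ _) (ef b)) ((fP b).2 u).
(* With d the mass of the symmetric difference of [A] and [D], the bounds e m(A) <= e m(D) + e d and
   e m(D) <= d contradict d (1 + e) < e m(A). *)
have d0 : 0 < e * m A / (1 + e) by rewrite divr_gt0 ?mulr_gt0// addr_gt0.
have [n [D [dD AD]]] := determined_approx mu mA d0.
have mD := measurable_determined dD.
have mAD := measurableY mA mD.
have h1 : m A <= m D + m (A `+` D).
  rewrite addrC; apply: le_trans (prU_le mu mAD mD).
  apply: pr_mono => //; first exact: measurableU.
  by move=> x Ax; have [Dx|Dx] := pselect (D x); [right|left; left].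
have h2 : m (D `\` A) <= m (A `+` D).
  by apply: pr_mono => //; [exact: measurableD|move=> x Dx; right].
have h3 := small D n dD.
have h4 : e * m A <= e * m D + e * m (A `+` D).
  by rewrite -mulrDr; apply: ler_wpM2l => //; exact: ltW.
have : m (A `+` D) * (1 + e) < e * m A by rewrite -ltr_pdivlMr// addr_gt0.
by move=> h5; nra.
Qed.

Lemma pr_cyl_rcons u a b :
  m (cyl (rcons (rcons u a) b)) = m (cyl (rcons u a)) * P a b.
Proof.
rewrite -!cats1; case: u => [|c u].
  by rewrite !cat0s cat1s !(pr_cyl mkv) /= !mulr1.
rewrite !cat_cons !(pr_cyl mkv) -mulrA; congr (_ * _).
by rewrite path_weight_cat last_cat /= mulr1.
Qed.

(** The extended cylinder keeps the share P(b,c) of the mass, so a relative error below e P(b,c)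
    before the step stays below e after it. *)
Lemma dense_after_step A b c : measurable A ->
  edge b c -> dense_after A b -> dense_after A c.
Proof.
move=> mA bc db e e0; have [u ub] := db (e * P b c) (mulr_gt0 e0 bc).
exists (rcons u b); rewrite pr_cyl_rcons (mulrC (m _)) mulrA.
apply: le_lt_trans ub; apply: pr_mono.
- by apply: measurableD => //; exact: measurable_cyl.
- by apply: measurableD => //; exact: measurable_cyl.
- by apply: setSD; rewrite -[X in cyl X `<=` _]cats1; exact: cyl_sub_cat.
Qed.

(* The translating element is the inverse of a word ending in [a] whose
   cylinder is almost filled by [A]. *)
Lemma almost_fill A a e : (forall b c, connect edge b c) ->
  measurable A -> 0 < m A -> 0 < e ->
  exists g, forall c, edge a c -> m (cyl [:: c] `\` beta g @` A) < e.
Proof.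
move=> conn mA A0 e0.
have da : dense_after A a.
  have [b db] := ex_dense_after mA A0.
  have /connectP[p pp ->] := conn b a.
  elim: p b pp db => //= c p IH b /andP[bc pp] db.
  by apply: IH pp _; exact: dense_after_step bc db.
(* Letters that do not follow [a] get the value 1, which keeps the minimum over all letters
   positive. *)
have Pa_gt0 c : 0 < (if edge a c then P a c else 1) :> R.
  by case: ifP => // _; exact: ltr01.
have [q q0 qP] := pos_lower_bound Pa_gt0.
have [u ua] := da (e * q) (mulr_gt0 e0 q0).
exists (gword (rcons u a))^-1%g => c ac.
set E := _ `\` _.
have mE : measurable E.
  apply: measurableD; first exact: measurable_cyl.
  exact: act_image_measurable.
(* The strict inequality [ua] excludes a null cylinder, hence a forbidden step. *)
have ru : sorted edge (rcons (rcons u a) c).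
  apply: contraT => /(pr_cyl_eq0 mkv); rewrite pr_cyl_rcons => /eqP.
  rewrite mulf_eq0 (gt_eqF (ac : 0 < P a c)) orbF => /eqP u0.
  by move: ua; rewrite u0 mulr0 ltNge pr_ge0.
have Ec : E `<=` cyl [:: c] by move=> x [].
have := pr_scale mkv (edge_reduced mkv ru) mE Ec.
(* The word carries the part of [c] missed by the translate into the part of its own cylinder missed
   by [A]. *)
have gE : m (beta (gword (rcons u a)) @` E) <= m (cyl (rcons u a) `\` A).
  apply: pr_mono; first exact: act_image_measurable.
    by apply: measurableD => //; exact: measurable_cyl.
  move=> _ [x [xc xA] <-]; split.
    apply: (@cyl_sub_cat _ _ [:: c]); rewrite -beta_gword_image.
      by exists x.
    exact: edge_reduced mkv _ ru.
  by move=> Ax; apply: xA; exists (beta (gword (rcons u a)) x); rewrite ?actVK.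
have := qP c; rewrite ac pr_cyl_rcons => qc.
have c1 : pi 0 c <= 1.
  have := pr_cyl mkv c [::]; rewrite [path_weight _ _ _]/= mulr1 => <-.
  by apply: pr_le1; exact: measurable_cyl.
move=> h; have u0 : 0 < m (cyl (rcons u a)).
  by rewrite (pr_cyl_gt0 mkv)//; move: ru; rewrite -cats1 => /cat_sorted2[].
have h1 : m (cyl (rcons u a)) * P a c * m E <= m (cyl (rcons u a) `\` A).
  rewrite -h; apply: le_trans gE.
  by rewrite -[leRHS]mulr1; apply: ler_wpM2l => //; exact: pr_ge0.
have h2 : m (cyl (rcons u a)) * P a c * m E < m (cyl (rcons u a)) * (e * P a c).
  apply: le_lt_trans h1 (lt_le_trans ua _).
  by rewrite mulrC; apply: ler_wpM2l; [exact: ltW|apply: ler_wpM2l;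
    [exact: ltW|]].
by move: h2; rewrite -mulrA (ltr_pM2l u0) mulrC (ltr_pM2r ac).
Qed.

End StrictlyIrreducible.

(** * Overlapping letters and the length of chains *)

Section Overlap.
Variables (R : realType) (r : nat).
Local Notation letter := (letter r.+1).
Local Notation X := (boundary r.+1).
Local Notation beta := (boundary_action r).
Variables (pi : 'rV[R]_(r.+1 + r.+1)) (P : 'M[R]_(r.+1 + r.+1)).
Variable mu : probability X R.
Hypothesis mkv : markov_measure pi P mu.
Hypothesis wis : weakly_inverse_symmetric P.
Implicit Types (a b c : letter) (u w : seq letter) (x y : X) (A B E : set X).
Local Notation m := (pr mu).
Local Notation edge := (edge P).

Definition overlap : rel letter := fun a b => [exists c, edge a c && edge b c].

Lemma overlap_sym : symmetric overlap.
Proof. by move=> a b; apply: eq_existsb => c; rewrite andbC. Qed.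

Lemma overlapI a b c : edge a c -> edge b c -> overlap a b.
Proof. by move=> ac bc; apply/existsP; exists c; rewrite ac bc. Qed.

Lemma overlap_refl : reflexive overlap.
Proof. by move=> a; have [c ac] := ex_edge mkv a; exact: (overlapI ac ac). Qed.

Lemma mulPPT_gt0 a b : (0 < (P *m P^T) a b) = overlap a b.
Proof.
rewrite mxE; apply/idP/existsP => [|[c /andP[ac bc]]]; last first.
  rewrite (bigD1 c)//= ltr_pwDl ?mxE ?mulr_gt0// sumr_ge0// => d _.
  by rewrite mxE mulr_ge0 ?(P_ge0 mkv).
apply: contraPP => h; apply/negP; rewrite -leNgt sumr_le0// => c _.
rewrite mxE leNgt; apply/negP => acb; apply: h; exists c; move: acb.
rewrite lt0r mulf_eq0 negb_or => /andP[/andP[ac cb] _].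
by rewrite /edge !lt_neqAle ![0 == _]eq_sym ac cb !(P_ge0 mkv).
Qed.

Lemma mulPPT_ge0 a b : 0 <= (P *m P^T) a b.
Proof. by rewrite mxE sumr_ge0// => c _; rewrite mxE mulr_ge0 ?(P_ge0 mkv). Qed.

Lemma connect_overlap a b :
  connect (fun a b => 0 < (P *m P^T) a b) a b = connect overlap a b.
Proof. by apply: eq_connect => c d; rewrite mulPPT_gt0. Qed.

Lemma strictly_irreducibleP : strictly_irreducible P <->
  (forall a b, exists2 c, edge a c & connect edge c b) /\
  (forall a b, connect overlap a b).
Proof.
split=> [[/mx_irreducibleP-/(_ (P_ge0 mkv)) h1 /mx_irreducibleP-/(_ mulPPT_ge0)
  h2]|[h1 h2]].
  split=> // a b; have [c ac cb] := h2 a b.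
  rewrite -connect_overlap; exact: connect_trans (connect1 ac) cb.
split; first by apply/(mx_irreducibleP (P_ge0 mkv)).
apply/(mx_irreducibleP mulPPT_ge0) => a b; exists a.
  by rewrite mulPPT_gt0 overlap_refl.
by rewrite connect_overlap.
Qed.

Lemma edge_linv a b : b != a -> b != linv a -> edge a b ->
  [/\ edge (linv a) b, edge a (linv b) & edge (linv a) (linv b)].
Proof.
move=> ba bVa ab; have E i j : edge (lpow a i) (lpow b j).
  apply: contraT => /(edgePn mkv)/(wis ba bVa i j) ab0.
  by move: ab; rewrite /edge ab0 ltxx.
by split; [have := E false true|have := E true false|have := E false false].
Qed.

Hypothesis conn : forall a b, connect edge a b.

(** As P(c^-1, c) = 0, failure means that [c] has no predecessor but itself; then no path from c^-1
    could reach [c]. *)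
Lemma ex_pred c : exists a, [/\ c != a, c != linv a & edge a c].
Proof.
apply: contrapT => /forallNP h.
have only a : edge a c -> a = c.
  move=> ac; have [->//|ca] := eqVneq c a.
  by case: (h a); split=> //; exact: edge_neq mkv _ _ ac.
have /connectP[p pp pc] := conn (linv c) c.
suff : linv c = c by move/eqP; rewrite (negbTE (linv_neq c)).
elim: p (linv c) pp pc => //= a p IH b /andP[ba pp] pc.
by apply: only; rewrite -(IH a pp pc).
Qed.

(** Dual to [ex_pred]: a letter followed only by itself never leads to its inverse. *)
Lemma ex_succ a : exists c, [/\ c != a, c != linv a & edge a c].
Proof.
apply: contrapT => /forallNP h.
have only c : edge a c -> c = a.
  move=> ac; have [//|ca] := eqVneq c a.
  by case: (h c); split=> //; exact: edge_neq mkv _ _ ac.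
have /connectP[p pp pc] := conn a (linv a).
suff : linv a = a by move/eqP; rewrite (negbTE (linv_neq a)).
rewrite [LHS]pc {pc}; move: pp; elim: p => //= c p IH /andP[ac pp].
by have ca := only _ ac; subst c; apply: IH.
Qed.

(** By weak inverse-symmetry, a successor of [a] other than a and a^-1 also follows a^-1. *)
Lemma overlap_linv a : overlap a (linv a).
Proof.
have [c [ca cVa ac]] := ex_succ a.
by have [Vac _ _] := edge_linv ca cVa ac; exact: overlapI ac Vac.
Qed.

Hypothesis oconn : forall a b, connect overlap a b.

(* Shortcutting at the inverse of the starting letter saves one step: this is
   what brings the chain length down to #|S| - 1. *)
Lemma short_overlap_path s b : exists a p,
  [/\ edge a s, path overlap a p, last a p = b & ((size p).+1 < #|letter|)%N].
Proof.
have size_lt (x y : letter) (p : seq letter) : uniq (x :: p) ->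
    y \notin x :: p -> ((size p).+1 < #|letter|)%N.
  move=> up yp; have : uniq (y :: x :: p) by rewrite /= yp.
  by move/card_uniqP => /= <-; exact: max_card.
have [a [sa sVa as_]] := ex_pred s.
have [Vas _ _] := edge_linv sa sVa as_.
have /connectP[p0 p0p ->] := oconn a b.
case/shortenP: p0p => p pp up _.
(* A path that avoids a^-1 misses a letter. Otherwise it is cut at a^-1, which also precedes [s],
   and what remains misses [a]. *)
have [Vap|Vap] := boolP (linv a \in a :: p); last first.
  by exists a, p; split=> //; exact: size_lt up Vap.
case/splitPl: Vap pp up => p1 p2 lp1; rewrite cat_path last_cat lp1.
move=> /andP[_ pp2]; rewrite -cat_cons cat_uniq => /and3P[_ dis up2].
have la : linv a \in a :: p1 by rewrite -lp1 mem_last.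
exists (linv a), p2; split=> //; apply: (size_lt (linv a) a).
  rewrite /= up2 andbT; apply: contra dis => Vap2; apply/hasP.
  by exists (linv a).
rewrite inE negb_or eq_sym linv_neq /=; apply: contra dis => ap2.
by apply/hasP; exists a; rewrite //= inE eqxx.
Qed.

Lemma pr_head A : measurable A -> m A = \sum_a m (A `&` cyl [:: a]).
Proof.
move=> mA; have E a : (fun x : X => x 0%N) @^-1` [set a] = cyl [:: a].
  by apply/seteqP; split=> x /cyl1.
rewrite (@pr_partition _ _ _ mu _ (fun x : X => x 0%N))//.
  by apply: eq_bigr => a _; rewrite E.
by move=> a; rewrite E; exact: measurable_cyl.
Qed.

Lemma ex_head A : measurable A -> 0 < m A -> exists a, 0 < m (A `&` cyl [:: a]).
Proof.
move=> mA; rewrite pr_head//; apply: contraPP => /forallNP h; apply/negP.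
by rewrite -leNgt sumr_le0// => a _; rewrite leNgt; apply/negP/h.
Qed.

Lemma pr_cyl1 a : m (cyl [:: a]) = pi 0 a.
Proof. by rewrite (pr_cyl mkv) [path_weight _ _ _]/= mulr1. Qed.

Lemma pr_meet A B C : measurable A -> measurable B -> measurable C ->
  m (A `&` C) <= m (B `&` A) + m (C `\` B).
Proof.
move=> mA mB mC; apply: le_trans (prU_le mu (measurableI _ _ mB mA)
  (measurableD mC mB)).
apply: pr_mono.
- exact: measurableI.
- by apply: measurableU; [exact: measurableI|exact: measurableD].
- by move=> x [Ax Cx]; have [Bx|Bx] := pselect (B x); [left|right].
Qed.

Lemma strictly_irreducible_chaining : chaining beta mu #|letter|.-1.
Proof.
move=> A B mA mB _ _; rewrite !pr_gt0// => A0 B0.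
have [s As] := ex_head mA A0; have [s' Bs'] := ex_head mB B0.
have [a' [_ _ as']] := ex_pred s'.
have [a [p [as_ pp pa' sp]]] := short_overlap_path s a'.
have [e0 e00 e0P] := pos_lower_bound (init_gt0 mkv).
(* Two translates that each miss less than e of a common cylinder of mass at least 3e must meet. The
   other two bounds make the first translate meet [A] and the last one meet [B]. *)
pose e := Num.min (m (A `&` cyl [:: s])) (Num.min (m (B `&` cyl [:: s'])) (e0 /
  3)).
have e_gt0 : 0 < e by rewrite !lt_min As Bs' divr_gt0.
have eA : e <= m (A `&` cyl [:: s]) by rewrite !ge_min lexx.
have eB : e <= m (B `&` cyl [:: s']) by rewrite !ge_min lexx orbT.
have epi c : 3 * e <= pi 0 c.
  by apply: le_trans (e0P c); rewrite mulrC -ler_pdivlMr// !ge_min lexx !orbT.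
have /choice[h hP] : forall a, exists g, forall c, edge a c ->
    m (cyl [:: c] `\` beta g @` A) < e.
  by move=> b; apply: (almost_fill mkv).
(* Past its end the path stays at a', which pads the chain to the exact length. *)
pose l i := nth a' (a :: p) i.
have ll i : (size p <= i)%N -> l i = a'.
  rewrite leq_eqVlt => /predU1P[<-|ip]; last by rewrite /l nth_default.
  by rewrite /l -last_nth -pa' /=; case: (p).
have ol i : overlap (l i) (l i.+1).
  have [ip|ip] := ltnP i (size p).
    by have /pathP := pp => /(_ a' i ip).
  by rewrite !ll ?overlap_refl// leqW.
have mh g : measurable (beta g @` A) by exact: act_image_measurable.
have mC c : measurable (cyl [:: c]) by exact: measurable_cyl.
exists (fun i => if i is j.+1 then h (l j) else 1%g); split=> //.
- case=> [_|i _].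
    have -> : beta 1%g @` A = A.
      by apply/seteqP; split=> [_ [x Ax <-]|x Ax] //; exists x.
    rewrite setIC pr_gt0; last exact: measurableI.
    have := pr_meet mA (mh (h a)) (mC s).
    by have := hP a s as_; rewrite /l /=; lra.
  rewrite pr_gt0; last exact: measurableI.
  have /existsP[c /andP[ic jc]] := ol i.
  have := pr_meet (mh (h (l i))) (mh (h (l i.+1))) (mC c).
  have := pr_split mu (mC c) (mh (h (l i))).
  have := hP _ _ ic; have := hP _ _ jc; have := epi c; rewrite pr_cyl1.
  by rewrite (setIC (beta (h (l i.+1)) @` A)) (setIC (cyl [:: c])); lra.
(* Here |S| = k + 2: the chain of length k + 1 ends with [h (l k)], and size p <= k gives l(k) =
   a'. *)
- move: sp; case: #|_| => // -[|k] //; rewrite !ltnS => sp.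
  change (0 < mu (beta (h (l k)) @` A `&` B))%E.
  rewrite ll// pr_gt0; last exact: measurableI.
  have := pr_meet mB (mh (h a')) (mC s').
  by have := hP a' s' as'; lra.
Qed.

End Overlap.

(** * The nonsingularization *)

Section NonsingularizationNull.
Variables (R : realType) (G : groupType) (d : measure_display).
Variables (X : measurableType d) (a : borel_action G X).
Variables (mu : probability X R) (gamma : nat -> G).
Hypothesis gammaP : forall g, exists n, gamma n = g.
Local Notation mt := (nonsingularization a mu gamma).

Lemma nonsingularization_eq0 A : measurable A ->
  mt A = 0%E <-> forall g, pr mu (a g @^-1` A) = 0.
Proof.
move=> mA; have mgA g : measurable (a g @^-1` A) by exact:
  act_preimage_measurable.
split=> [mtA g|gA]; last first.
  rewrite /nonsingularization eseries0// => n _ _.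
  by rewrite /translate /pushforward prE// gA mule0.
have [n <-] := gammaP g; apply/eqP; rewrite eq_le pr_ge0 andbT leNgt.
apply/negP => gA; suff : (0 < mt A)%E by rewrite mtA ltxx.
pose F n := (((2^-1 ^+ n.+1)%R)%:E * translate a mu (gamma n) A)%E.
have F0 k : (0 <= F k)%E.
  by rewrite /F mule_ge0// /translate /pushforward measure_ge0.
apply: lt_le_trans (@nneseries_lim_ge _ F xpredT 0 n.+1 _) => //.
(* The partial sum with n+1 terms ends with the n-th term, which is positive. *)
rewrite big_nat_recr//=; apply: lt_le_trans (leeDr _ _); last exact: sume_ge0.
by rewrite /F /translate /pushforward prE// -EFinM lte_fin mulr_gt0.
Qed.

Lemma nonsingularization_gt0 A : measurable A -> 0 < pr mu A -> (0 < mt A)%E.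
Proof.
move=> mA A0; rewrite lt0e measure_ge0 andbT; apply/eqP.
move=> /(nonsingularization_eq0 mA)/(_ 1%g).
have -> : a 1%g @^-1` A = A.
  by apply/seteqP; split=> x; rewrite /= (act_axiom a).1.
by move=> A0'; rewrite A0' ltxx in A0.
Qed.

End NonsingularizationNull.

(** * Null sets inside the admissible sequences *)

Section AdmissibleNull.
Variables (R : realType) (r : nat).
Local Notation letter := (letter r.+1).
Local Notation X := (boundary r.+1).
Local Notation beta := (boundary_action r).
Variables (pi : 'rV[R]_(r.+1 + r.+1)) (P : 'M[R]_(r.+1 + r.+1)).
Variable mu : probability X R.
Hypothesis mkv : markov_measure pi P mu.
Implicit Types (a b c : letter) (u w : seq letter) (x y : X) (A B E : set X).
Local Notation m := (pr mu).
Local Notation edge := (edge P).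
Local Notation W := (@admissible R r P).

(** If x starts with b^-1, it is b^-1 put in front of a point of [A], and scaling shows that each
    such piece is null. Otherwise b x in [W] makes the step from b to x_0 an edge, so the scaling
    factor is positive and nullity passes back. *)
Lemma pr_preimage_gen0 b A : measurable A -> A `<=` W -> m A = 0 ->
  m (W `&` beta (fgen b) @^-1` A) = 0.
Proof.
move=> mA AW A0; have mW := measurable_admissible P.
have mE : measurable (W `&` beta (fgen b) @^-1` A).
  by apply: measurableI => //; exact: act_preimage_measurable.
rewrite pr_head// big1// => d _.
have mEd : measurable (W `&` beta (fgen b) @^-1` A `&` cyl [:: d]).
  by apply: measurableI => //; exact: measurable_cyl.
have [dE|db] := eqVneq d (linv b).
  (* After b^-1 has been cancelled the sequence cannot start with [b], hence the empty piece. *)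
  pose F c : set X := if c == b then set0
    else beta (fgen (linv b)) @` (A `&` cyl [:: c]).
  have mAc c : measurable (A `&` cyl [:: c]).
    by apply: measurableI => //; exact: measurable_cyl.
  have mF c : measurable (F c).
    by rewrite /F; case: ifP => // _; exact: act_image_measurable.
  apply: (@pr_sub0 _ _ _ mu _ (\bigcup_c F c)) => //;
    first exact: measurable_bigcup_count.
    move=> x [[Wx /= bxA] [xd _]].
    exists (x 1%N) => //; rewrite /F ifN;
      last by rewrite -(linvK b) -dE -xd bseqP.
    exists (bact (fgen b) x); last by rewrite -[RHS](bconsK (linv b)) linvK.
    split=> //; apply/cyl1; rewrite -[bact _ _]/(bcons b x) -(linvK b).
    by rewrite bcons_shift// xd.
  apply: pr_bigcup_count0 => // c; rewrite /F; case: eqP => [_|/eqP cb].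
    exact: pr0.
  have cVb : c != linv (linv b) by rewrite linvK.
  have := pr_scale1 mkv cVb (mAc c) (@subIsetr _ _ _).
  rewrite (_ : m (A `&` _) = 0); last exact: pr_sub0 (@subIsetl _ _ _) A0.
  by move/eqP; rewrite mulr0 mulf_eq0 (gt_eqF (init_gt0 mkv c)) orbF => /eqP.
have [bd|/negP bd] := boolP (edge b d); last first.
  rewrite -[RHS](pr0 mu); congr m; rewrite -subset0 => x [[_ /AW bxW] [xd _]].
  apply: bd; have xb : x 0%N != linv b by rewrite xd.
  by have := bxW 0%N; rewrite beta_gen !bcons_cons// xd.
have := pr_scale1 mkv db mEd (@subIsetr _ _ _).
rewrite (_ : m (beta (fgen b) @` _) = 0).
  rewrite mul0r => /esym/eqP; rewrite !mulf_eq0 (gt_eqF (init_gt0 mkv b)) /=.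
  by rewrite (gt_eqF (bd : 0 < P b d)) => /eqP.
apply: (@pr_sub0 _ _ _ mu _ A) => //; first exact: act_image_measurable.
by move=> _ [x [[_ bxA] _] <-].
Qed.

(** Once a letter survives, reducedness prevents any further cancellation: either the first letter
    stays, or the whole word has been cancelled against [x]. *)
Lemma head_or_tail b u x : reduced (b :: u) ->
  beta (gword (b :: u)) x 0%N = b \/
  exists n, forall i, beta (gword (b :: u)) x i = x (i + n)%N.
Proof.
elim: u b => [|c u IH] b bu; rewrite beta_gword_cons.
  have [xb|xb] := eqVneq (x 0%N) (linv b); last by left; rewrite bcons_cons.
  by right; exists 1%N => i; rewrite -(linvK b) bcons_shift//= addn1.
set y := beta (gword (c :: u)) x.
have [yb|yb] := eqVneq (y 0%N) (linv b); last by left; rewrite bcons_cons.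
right; have [cu|[n yn]] := IH c (path_sorted bu).
  by move: bu; rewrite /reduced /= -yb -cu eqxx.
exists n.+1 => i; rewrite -(linvK b) bcons_shift// -[LHS]/(y i.+1).
by rewrite yn; congr (Defs.bseq x _); rewrite addSnnS.
Qed.

(** If [b] survives, the point before it is a tail of an admissible sequence. If [b] cancels, that
    point starts with b^-1, which is not the first letter of [u], so by [head_or_tail] it is a tail
    of [x]. *)
Lemma admissible_step b u x : reduced (b :: u) -> W x ->
  W (beta (gword (b :: u)) x) -> W (beta (gword u) x).
Proof.
move=> bu xW; rewrite beta_gword_cons; set y := beta (gword u) x => byW.
have [yb|yb] := eqVneq (y 0%N) (linv b); last first.
  by move=> i; have := byW i.+1; rewrite !bcons_cons.
case: u bu @y byW yb => [//|c u] bu y _ yb.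
have [cu|[n yn]] := @head_or_tail c u x (path_sorted bu).
  by move: bu; rewrite /reduced /= -yb -cu eqxx.
by move=> i; rewrite !yn; exact: xW.
Qed.

(** [admissible_step] keeps the intermediate points in [W], so the generator case applies letter by
    letter. *)
Lemma pr_preimage_word0 u A : reduced u -> measurable A -> A `<=` W -> m A = 0
  ->
  m (W `&` beta (gword u) @^-1` A) = 0.
Proof.
have mW := measurable_admissible P.
elim: u A => [|b u IH] A bu mA AW A0.
  have sub : W `&` beta (gword [::]) @^-1` A `<=` A by move=> x [].
  apply: (pr_sub0 _ mA sub A0).
  by apply: measurableI => //; exact: act_preimage_measurable.
have mbA := act_preimage_measurable beta (fgen b) mA.
have mE := measurableI _ _ mW mbA.
have := IH _ (path_sorted bu) mE (@subIsetl _ _ _) (pr_preimage_gen0 b mA AW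
  A0).
apply: pr_sub0.
- by apply: measurableI => //; exact: act_preimage_measurable.
- by apply: measurableI => //; exact: act_preimage_measurable.
- move=> x [xW xA]; split=> //; split.
    exact: admissible_step bu xW (AW _ xA).
  by move: xA; rewrite /= bactM.
Qed.

Lemma pr_preimage0 g A : measurable A -> A `<=` W -> m A = 0 ->
  m (beta g @^-1` A) = 0.
Proof.
move=> mA AW A0; have mW := measurable_admissible P.
have mgA := act_preimage_measurable beta g mA.
have := pr_preimage_word0 (fword_reduced g) mA AW A0; rewrite gwordE => WA.
rewrite (pr_split mu mgA mW) setIC WA addr0.
apply: (@pr_sub0 _ _ _ mu _ (~` W)); first exact: measurableD.
- exact: measurableC.
- by move=> x [].
- by rewrite pr_setC// (pr_admissible mkv) subrr.
Qed.

Variable gamma : nat -> free_group r.+1.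
Hypothesis gammaP : forall g, exists n, gamma n = g.
Local Notation mt := (nonsingularization beta mu gamma).

(** This lets chaining pass from [mu] to its nonsingularization: by [pr_preimage0], nullity inside
    [W] spreads to all translates. *)
Lemma nonsingularization_admissible A : measurable A -> A `<=` W ->
  (0 < mt A)%E = (0 < mu A)%E.
Proof.
move=> mA AW; apply/idP/idP => [|A0]; last first.
  by apply: nonsingularization_gt0 => //; rewrite -pr_gt0.
move=> mtA; rewrite pr_gt0// lt0r pr_ge0 andbT; apply/eqP => A0.
have : mt A = 0%E.
  by apply/(nonsingularization_eq0 _ _ gammaP) => // g; exact: pr_preimage0.
by move=> mtA0; rewrite mtA0 ltxx in mtA.
Qed.

Lemma pr_admissible_cyl1 c : m (W `&` cyl [:: c]) = pi 0 c.
Proof.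
have mC : measurable (cyl [:: c]) by exact: measurable_cyl.
have mW := measurable_admissible P.
have := pr_split mu mC mW; rewrite (pr_cyl1 mkv) setIC => ->.
rewrite (@pr_sub0 _ _ _ mu (cyl [:: c] `\` W) (~` W)) ?add0r//.
- exact: measurableD.
- exact: measurableC.
- by rewrite pr_setC// (pr_admissible mkv) subrr.
Qed.

(** For the generation clause of essential chaining. Along an edge from [c] to d, the part of [W] in
    [d] is moved into [W] with positive mass. *)
Lemma pr_translate_admissible c :
  0 < m (beta (fgen c) @` W `&` W).
Proof.
have mW := measurable_admissible P; have [d cd] := ex_edge mkv c.
have mC : measurable (cyl [:: d]) by exact: measurable_cyl.
have mWd := measurableI _ _ mW mC.
have := pr_scale1 mkv (edge_neq mkv cd) mWd (@subIsetr _ _ _).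
rewrite pr_admissible_cyl1 => h.
have : 0 < m (beta (fgen c) @` (W `&` cyl [:: d])).
  have pd := init_gt0 mkv d.
  by rewrite -(pmulr_lgt0 _ pd) h !mulr_gt0// (init_gt0 mkv).
move=> /lt_le_trans; apply; apply: pr_mono.
- exact: act_image_measurable.
- by apply: measurableI => //; exact: act_image_measurable.
- move=> _ [x [xW [xd _]] <-]; split; first by exists x.
  have xc : x 0%N != linv c by rewrite xd; exact: (edge_neq mkv cd).
  by move=> [|i]; rewrite beta_gen !bcons_cons//= xd.
Qed.

(** A point with a translate outside the saturation is itself outside [O], so all preimages of the
    complement are null. *)
Lemma saturation_conull (O : set X) : measurable O -> m O = 1 ->
  mt.-negligible (~` \bigcup_(g in [set: free_group r.+1]) beta g @` O).
Proof.
move=> mO O1; set N := ~` _.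
have mN : measurable N.
  apply: measurableC; apply: measurable_bigcup_count => g.
  exact: act_image_measurable.
apply/negligibleP => //; apply/(nonsingularization_eq0 _ _ gammaP) => // g.
apply: (@pr_sub0 _ _ _ mu _ (~` O)).
- exact: act_preimage_measurable.
- exact: measurableC.
- by move=> x xN xO; apply: xN; exists g => //; exists x.
- by rewrite pr_setC// O1 subrr.
Qed.

Lemma chaining_essentially k : chaining beta mu k -> essentially_chaining beta
  mt k.
Proof.
move=> ch; have mW := measurable_admissible P; exists W; split=> //.
- move=> A B mA mB AW BW; rewrite !nonsingularization_admissible// => A0 B0.
  have [g [g0 gA gB]] := ch A B mA mB (@subsetT _ _) (@subsetT _ _) A0 B0.
  have mg h : measurable (beta h @` A) by exact: act_image_measurable.
  exists g; split=> // [i ik|]; apply: nonsingularization_gt0 => //.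
  + exact: measurableI.
  + by rewrite -pr_gt0; [exact: gA|exact: measurableI].
  + exact: measurableI.
  + by rewrite -pr_gt0; [exact: gB|exact: measurableI].
- exact: saturation_conull (pr_admissible mkv).
- move=> H [H1 HV] HE g; rewrite -[g]gwordE; elim: (fword g) => //= c u IH.
  apply: (group_closedM (conj H1 HV)) => //; apply: HE.
  apply: nonsingularization_gt0 => //; last exact: pr_translate_admissible.
  by apply: measurableI => //; exact: act_image_measurable.
Qed.

End AdmissibleNull.

(** * Metric ergodicity *)

Section EssentiallyConstant.
Variables (R : realType) (G : groupType) (d : measure_display).
Variables (X : measurableType d) (a : borel_action G X) (mu : probability X R).
Variables (Z : Type) (b : G -> Z -> Z) (near : R -> Z -> Z -> Prop).
Hypothesis near_sym : forall e z z', near e z z' -> near e z' z.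
Hypothesis near_trans : forall e e' z z' z'',
  near e z z' -> near e' z' z'' -> near (e + e') z z''.
Hypothesis near_act : forall g e z z', near e z z' -> near e (b g z) (b g z').
Variable f : X -> Z.
Hypothesis f_equiv : forall g x, f (a g x) = b g (f x).

(** Distance zero in the invariant pseudometric for which [near e] means distance below e. A
    relation replaces the distance function, so that one argument serves both metric spaces and
    arbitrary subsets of a measure space. *)
Definition infinitely_near z z' := forall n, near n.+1%:R^-1 z z'.

Lemma infinitely_near_trans z z' z'' :
  infinitely_near z z' -> infinitely_near z' z'' -> infinitely_near z z''.
Proof.
move=> h h' n; have -> : n.+1%:R^-1 = n.*2.+1.+1%:R^-1 + n.*2.+1.+1%:R^-1 :> R.
  rewrite -doubleS -muln2 natrM.
  have : n.+1%:R != 0 :> R by rewrite pnatr_eq0.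
  by move: (n.+1%:R) => t t0; field.
exact: near_trans (h _) (h' _).
Qed.

Lemma infinitely_near_act g z z' :
  infinitely_near z z' -> infinitely_near (b g z) (b g z').
Proof. by move=> h n; apply: near_act. Qed.

(** Passing to the next translate through a common point costs 2e: the value there is within e of
    g_(i+1) z, and so is every value on the next translate. With one e at each end the total is (2k
    + 2) e. *)
Lemma chains_near k e z z' (A B : set X) :
  (forall x, A x -> near e z (f x)) -> (forall x, B x -> near e z' (f x)) ->
  chains a mu k A B -> near (e *+ k.+1.*2) z z'.
Proof.
move=> Az Bz' [g [g0 gA gB]].
have meet (C : set X) : (0 < mu C)%E -> exists x, C x.
  by have [->|/set0P//] := eqVneq C set0; rewrite measure0 ltxx.
have near_gA i x : (a (g i) @` A) x -> near e (b (g i) z) (f x).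
  by move=> [y Ay <-]; rewrite f_equiv; apply/near_act/Az.
have near_z i : (i <= k)%N -> forall x, (a (g i) @` A) x -> near (e *+ i.*2.+1)
  z (f x).
  elim: i => [_ x [y Ay <-]|i IH ik x gx].
    by rewrite g0 (act_axiom a).1; exact: Az.
  have [y [yi yi1]] := meet _ (gA i ik).
  have := near_trans (near_trans (IH (ltnW ik) y yi) (near_sym (near_gA _ _
    yi1))) (near_gA _ _ gx).
  by rewrite -!mulrSr doubleS.
have [x [gx Bx]] := meet _ gB.
rewrite doubleS mulrSr.
exact: near_trans (near_z _ (leqnn k) _ gx) (near_sym (Bz' _ Bx)).
Qed.

(** Discard the null pieces of the cover. Any two remaining pieces are joined by a chain, so the
    values of [f] on them are within (2k + 4) e of each other. *)
Lemma chaining_ess_const k : chaining a mu k ->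
  (forall e, 0 < e -> exists (I : countType) (z : I -> Z) (A : I -> set X),
    [/\ forall i, measurable (A i), forall i x, A i x -> near e (z i) (f x)
      & pr mu (~` \bigcup_i A i) = 0]) ->
  exists V, [/\ measurable V, pr mu V = 1
    & forall x y, V x -> V y -> infinitely_near (f x) (f y)].
Proof.
move=> ch cov.
have /choice[V VP] : forall n, exists V, [/\ measurable V, pr mu (~` V) = 0
    & forall x y, V x -> V y -> near n.+1%:R^-1 (f x) (f y)].
  (* The denominator is 2 (k + 2): 2k + 2 for the chain and 1 for each endpoint. *)
  move=> n; pose e : R := n.+1%:R^-1 / k.+2.*2%:R.
  have e0 : 0 < e by rewrite divr_gt0// ?invr_gt0 ltr0n ?double_gt0.
  have [I [z [A [mA Az A0]]]] := cov e e0.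
  pose B i := if (0 < mu (A i))%E then A i else set0.
  have mB i : measurable (B i) by rewrite /B; case: ifP.
  pose C i := if (0 < mu (A i))%E then set0 else A i.
  have mC i : measurable (C i) by rewrite /C; case: ifP.
  have mUA := measurable_bigcup_count mA;
    have mUB := measurable_bigcup_count mB.
  have mUC := measurable_bigcup_count mC.
  exists (\bigcup_i B i); split=> //.
    apply: (@pr_sub0 _ _ _ _ _ (~` (\bigcup_i A i) `|` \bigcup_i C i)).
    - exact: measurableC.
    - by apply: measurableU => //; exact: measurableC.
    - move=> x Bx; have [[i _ Ax]|] := pselect ((\bigcup_i A i) x);
      last by left.
      right; exists i => //; rewrite /C; case: ifP => // Ai.
      by apply: Bx; exists i => //; rewrite /B Ai.
    - apply/eqP; rewrite eq_le pr_ge0 andbT.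
      apply: le_trans (prU_le mu (measurableC mUA) mUC) _.
      rewrite A0 add0r pr_bigcup_count0// => i; rewrite /C.
      case: ifPn => [_|]; first exact: pr0.
      by rewrite pr_gt0// lt0r pr_ge0 andbT negbK => /eqP.
  move=> x y [i _]; rewrite /B; case: ifP => // Ai Ax [j _]; rewrite /B.
  case: ifP => // Aj Ay.
  have := chains_near (Az i) (Az j)
    (ch _ _ (mA i) (mA j) (@subsetT _ _) (@subsetT _ _) Ai Aj) => zz.
  have := near_trans (near_trans (near_sym (Az i x Ax)) zz) (Az j y Ay).
  congr (near _ _ _).
  by rewrite -mulrS -mulrSr -doubleS -[LHS]mulr_natr /e divfK// pnatr_eq0
    double_eq0.
exists (\bigcap_n V n).
have mV n : measurable (V n) by case: (VP n).
have mV' : measurable (\bigcap_n V n) by exact: bigcap_measurable.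
split=> //; last by move=> x y Vx Vy n; case: (VP n) => _ _; apply;
  [exact: Vx|exact: Vy].
apply/eqP; rewrite eq_sym -subr_eq0 -pr_setC// setC_bigcap;
  apply/eqP/pr_bigcup0.
  by move=> n; exact: measurableC.
by move=> n; case: (VP n).
Qed.

End EssentiallyConstant.

Section MetricErgodicity.
Variables (R : realType) (r : nat).
Local Notation letter := (letter r.+1).
Local Notation X := (boundary r.+1).
Local Notation beta := (boundary_action r).
Variables (pi : 'rV[R]_(r.+1 + r.+1)) (P : 'M[R]_(r.+1 + r.+1)).
Variable mu : probability X R.
Hypothesis mkv : markov_measure pi P mu.
Local Notation m := (pr mu).
Local Notation edge := (edge P).

Lemma pr1_ex (V : set X) : m V = 1 -> exists x, V x.
Proof.
have [->|/set0P//] := eqVneq V set0.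
by rewrite pr0 => /esym/eqP; rewrite oner_eq0.
Qed.

(** A translate of a conull set need not be conull. But along an edge from [c] to d, translation by
    [c] rescales masses in [d] by a positive factor, so it cannot move all of V in [d] off [V]. *)
Lemma pr1_ex_gen (V : set X) c : measurable V -> m V = 1 ->
  exists x, V x /\ V (beta (fgen c) x).
Proof.
move=> mV V1; apply: contrapT => /forallNP h.
have [d cd] := ex_edge mkv c.
have mC : measurable (cyl [:: d]) by exact: measurable_cyl.
have mE := measurableI _ _ mV mC.
have V0 : m (~` V) = 0 by rewrite pr_setC// V1 subrr.
have := pr_scale1 mkv (edge_neq mkv cd) mE (@subIsetr _ _ _).
rewrite (@pr_sub0 _ _ _ mu (beta (fgen c) @` _) (~` V)) ?mul0r//.
- move/esym/eqP; rewrite !mulf_eq0 (gt_eqF (init_gt0 mkv c)).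
  rewrite (gt_eqF (cd : 0 < P c d)) /= => /eqP Vd0.
  have := pr_split mu mC mV; rewrite setIC Vd0 addr0 (pr_cyl1 mkv).
  have -> : m (cyl [:: d] `\` V) = 0.
    apply: (@pr_sub0 _ _ _ mu _ (~` V)) => //.
      exact: measurableD.
    exact: measurableC.
  by move/eqP; rewrite (gt_eqF (init_gt0 mkv d)).
- exact: act_image_measurable.
- exact: measurableC.
- by move=> _ [x [Vx _] <-] cOx; apply: (h x).
Qed.

Variable gamma : nat -> free_group r.+1.
Hypothesis gammaP : forall g, exists n, gamma n = g.
Local Notation mt := (nonsingularization beta mu gamma).

Lemma ball_mdist_open (Z : metricType R) (z : Z) e : open [set y | mdist z y <
  e].
Proof.
rewrite openE => y /= zy; rewrite /interior -nbhs_ballE.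
exists (e - mdist z y); first by rewrite /= subr_gt0.
move=> t; rewrite ballEmdist /= => yt.
by apply: le_lt_trans (metric_triangle _ y _) _; rewrite -ltrBrDl.
Qed.

Lemma separable_seq (Z : metricType R) (z0 : Z) : separable Z ->
  exists s : nat -> Z, forall e z, 0 < e -> exists n, mdist (s n) z < e.
Proof.
move=> [D [cD dD]].
have [D0|[s]] := pfcard_geP cD.
  have neT : [set: Z] !=set0 by exists z0.
  by have [x [_]] := dD _ neT openT; rewrite D0.
exists s => e z e0.
have ne : [set y | mdist z y < e] !=set0 by exists z; rewrite /= mdistxx.
have [y [zy Dy]] := dD _ ne (@ball_mdist_open _ z e).
have [n _ sn] := 'surj_s Dy.
by exists n; rewrite sn metric_sym.
Qed.

(** The common value of [f] on a conull set is fixed by every generator, because the generator moves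
    some point of this set into it. The value then spreads to the saturation of the set. *)
Lemma chaining_metrically_ergodic k : chaining beta mu k ->
  metrically_ergodic beta mt.
Proof.
move=> ch Z b sepZ [b1 bM] iso f mf f_equiv.
pose near e (z z' : Z) := mdist z z' < e.
have near_sym e z z' : near e z z' -> near e z' z by rewrite /near metric_sym.
have near_trans e e' z z' z'' : near e z z' -> near e' z' z'' -> near (e + e')
  z z''.
  by move=> h h'; apply: le_lt_trans (metric_triangle _ z' _) _; exact: ltrD.
have near_act g e z z' : near e z z' -> near e (b g z) (b g z') by rewrite
  /near iso.
have [s sP] := separable_seq (f point) sepZ.
have [|V [mV V1 Vf]] := chaining_ess_const near_sym near_trans near_act f_equiv
  ch.
  move=> e e0; exists nat, s.
  (* Preimages of balls are measurable only up to null sets: each is replaced by a measurable set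
     minus a null set. A null set of the nonsingularization is null for [mu]. *)
  have /choice[BN BNP] : forall n, exists BN : set X * set X,
      [/\ measurable BN.1, measurable BN.2, m BN.2 = 0 &
        (f @^-1` [set y | mdist (s n) y < e]) `+` BN.1 `<=` BN.2].
    move=> n; have [|B [mB [N [mN N0 BN]]]] := mf [set y | mdist (s n) y < e].
      by apply: sub_sigma_algebra; exact: ball_mdist_open.
    exists (B, N); split=> //.
    have /(_ 1%g) := (nonsingularization_eq0 _ _ gammaP mN).1 N0.
    by congr (m _ = 0).
  have mB n : measurable (BN n).1 by case: (BNP n).
  have mN n : measurable (BN n).2 by case: (BNP n).
  exists (fun n => (BN n).1 `\` (BN n).2); split.
  - by move=> n; exact: measurableD.
  - move=> n x [Bx Nx]; have [_ _ _ sub] := BNP n.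
    by apply: contrapT => h; apply: Nx; apply: sub; right.
  - apply: (@pr_sub0 _ _ _ _ _ (\bigcup_n (BN n).2)).
    + by apply: measurableC; apply: bigcup_measurable => n _;
      exact: measurableD.
    + exact: bigcup_measurable.
    + move=> x xA; have [n xn] := sP e (f x) e0; exists n => //.
      apply: contrapT => Nx; have [_ _ _ sub] := BNP n.
      have [Bx|Bx] := pselect ((BN n).1 x); last by apply: Nx; apply: sub; left.
      by apply: xA; exists n.
    + by apply: pr_bigcup0 => // n; case: (BNP n).
have Veq x y : V x -> V y -> f x = f y.
  move=> Vx Vy; apply: mdist_positivity; apply/eqP;
    rewrite eq_le mdist_ge0 andbT.
  apply/ler_addgt0Pl => e e0; rewrite addr0.
  have [n ne] : exists n, n.+1%:R^-1 < e.
    by have [n ne] := ltr_add_invr e0; exists n; rewrite add0r in ne.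
  by apply: ltW; apply: lt_trans ne; exact: Vf.
have [x0 Vx0] := pr1_ex V1; exists (f x0).
have fixed g : b g (f x0) = f x0.
  rewrite -[g]gwordE; elim: (fword g) => [|c u IH] /=; first by rewrite b1.
  rewrite bM IH; have [x [Vx Vcx]] := pr1_ex_gen c mV V1.
  by rewrite -(Veq _ _ Vx Vx0) -f_equiv (Veq _ _ Vcx Vx).
apply: (negligibleS _ (saturation_conull gammaP mV V1)) => x /= fx [g _ [y Vy
  yx]].
by apply: fx; rewrite -yx f_equiv (Veq _ _ Vy Vx0).
Qed.

End MetricErgodicity.

(** * Weak mixing *)

Section Sections.
Variables (R : realType) (d d' : measure_display).
Variables (X : measurableType d) (Y : measurableType d').
Variables (mu : probability X R) (nu : probability Y R).
Implicit Types S : set (X * Y).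

Lemma measurable_section_ge S e : measurable S ->
  measurable [set x | e <= pr nu (xsection S x)].
Proof.
move=> mS; have mf := measurable_fun_xsection nu mS.
have -> : [set x | e <= pr nu (xsection S x)] =
    setT `&` [set x | (e%:E <= (nu \o xsection S) x)%E].
  rewrite setTI; apply/seteqP; split=> x /=;
    by rewrite (prE nu (measurable_xsection x mS)) lee_fin.
exact: measurable_lee (measurable_cst _) mf.
Qed.

(** Markov's inequality for x |-> nu(S_x), whose integral is the product mass. *)
Lemma pr_section_ge S e : measurable S -> 0 < e ->
  e * pr mu [set x | e <= pr nu (xsection S x)] <= pr (mu \x nu)%E S.
Proof.
move=> mS e0; have mf := measurable_fun_xsection nu mS.
have m1 := measurable_section_ge e mS.
have := le_integral_abse mu measurableT mf e0.
rewrite (_ : \int[mu]_(x in setT) _ = (mu \x nu)%E S)%E; last first.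
  by apply: eq_integral => x _; rewrite gee0_abs.
rewrite (_ : setT `&` _ = [set x | e <= pr nu (xsection S x)]); last first.
  rewrite setTI; apply/seteqP; split=> x /=;
    by rewrite gee0_abs// (prE nu (measurable_xsection x mS)) lee_fin.
by rewrite -lee_fin EFinM -(prE mu m1) -(prE (mu \x nu)%E mS).
Qed.

Lemma section_positive S :
  [set x | pr nu (xsection S x) != 0] =
  \bigcup_n [set x | n.+1%:R^-1 <= pr nu (xsection S x)].
Proof.
apply/seteqP; split=> [x /= Sx|x [n _ /= nx]]; last first.
  by rewrite gt_eqF// (lt_le_trans _ nx)// invr_gt0.
have Sx0 : 0 < pr nu (xsection S x) by rewrite lt_neqAle eq_sym Sx pr_ge0.
by have [n] := ltr_add_invr Sx0; rewrite add0r => /ltW nx; exists n.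
Qed.

Lemma measurable_section_positive S : measurable S ->
  measurable [set x | pr nu (xsection S x) != 0].
Proof.
move=> mS; rewrite section_positive; apply: bigcup_measurable => n _.
exact: measurable_section_ge.
Qed.

Lemma pr_section0 S : measurable S ->
  pr (mu \x nu)%E S = 0 <-> pr mu [set x | pr nu (xsection S x) != 0] = 0.
Proof.
move=> mS; split=> S0.
  rewrite section_positive; apply: pr_bigcup0 => n.
    exact: measurable_section_ge.
  have n0 : 0 < n.+1%:R^-1 :> R by rewrite invr_gt0.
  have := pr_section_ge mS n0; rewrite S0 pmulr_rle0// => h.
  by apply/eqP; rewrite eq_le h pr_ge0.
have mf := measurable_fun_xsection nu mS.
rewrite /pr [X in fine X](_ : _ = 0%E)//.
transitivity (\int[mu]_x (cst 0%E x : \bar R))%E; last by rewrite integral0.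
apply: ge0_ae_eq_integral => //.
apply: negligibleS ((pr_eq0 mu (measurable_section_positive mS)).1 S0) => x /=
  h.
apply: contra_notN h => /eqP h _ /=.
by rewrite (prE nu (measurable_xsection x mS)) h.
Qed.

End Sections.

(** * Approximation in the product *)

Section ProductApproximation.
Variables (R : realType) (r : nat) (d : measure_display) (Y : measurableType d).
Local Notation letter := (letter r.+1).
Local Notation X := (boundary r.+1).
Variables (mu : probability X R) (nu : probability Y R).

(** Finite unions of products of a cylinder and a subset of [Y]; only the values of [B] on words of
    length n matter. Such a set has finitely many distinct fibres. *)
Definition prefix_set n (B : seq letter -> set Y) : set (X * Y) :=
  [set z : X * Y | B (mkseq z.1 n) z.2].

Lemma measurable_prefix_set n B : (forall u, measurable (B u)) ->
  measurable (prefix_set n B).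
Proof.
move=> mB; have -> : prefix_set n B =
    \bigcup_u ((if size u == n then cyl u else set0) `*` B u).
  apply/seteqP; split=> [[x y] xy|[x y] [u _]].
    by exists (mkseq x n) => //; rewrite size_mkseq eqxx; split=> //;
      exact: cyl_mkseq.
  by case: eqP => [<-|_] [//= /cylP xu uy]; rewrite /prefix_set /= xu.
apply: measurable_bigcup_count => u; apply: measurableX => //.
by case: ifP => _ //; exact: measurable_cyl.
Qed.

Lemma product_approx S e : measurable S -> 0 < e ->
  exists n B, (forall u, measurable (B u)) /\
    pr (mu \x nu)%E (S `+` prefix_set n B) < e.
Proof.
move=> mS e0.
pose G := [set D | exists n B, (forall u, measurable (B u)) /\ D = prefix_set n
  B].
have [||||| _ aS] := @approximable_sigma_algebra R _ _ (mu \x nu)%E G _ _ _ _ S.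
- by exists 0%N, (fun=> set0).
- move=> _ [n [B [mB ->]]]; exists n, (fun u => ~` B u).
  by split=> // u; exact: measurableC.
- move=> _ _ [n [B [mB ->]]] [k [C [mC ->]]].
  exists (maxn n k), (fun u => B (take n u) `|` C (take k u)).
  split=> [u|]; first exact: measurableU.
  apply/seteqP; split=> z; rewrite /prefix_set /= /mkseq -!map_take !take_iota;
    by rewrite (minn_idPl (leq_maxl n k)) (minn_idPl (leq_maxr n k)).
- by move=> _ [n [B [mB ->]]]; exact: measurable_prefix_set.
- move: S mS; apply: smallest_sub; first exact: smallest_sigma_algebra.
  move=> _ [[A mA <-]|[A mA <-]]; last first.
    by apply: sub_sigma_algebra; exists 0%N, (fun=> A); rewrite setTI.
  move: A mA; apply: (@smallest_sub _ _ _ (image_set_system setT fst <<s G>>)).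
    by apply: sigma_algebra_image; exact: smallest_sigma_algebra.
  move=> _ [w [n ->]]; apply: sub_sigma_algebra; rewrite setTI cylinder_cyl.
  exists n, (fun u => if u == mkseq w n then setT else set0).
  split=> [u|]; first by case: ifP.
  apply/seteqP; split=> -[x y] /=; rewrite /prefix_set /=.
    by move=> /cylP; rewrite size_mkseq => ->; rewrite eqxx.
  by case: eqP => // xw _; apply/cylP; rewrite size_mkseq.
have [_ [n [B [mB ->]]] SD] := aS e e0.
exists n, B; split=> //; rewrite -lte_fin -prE//; apply: measurableY => //.
exact: measurable_prefix_set.
Qed.

End ProductApproximation.

Lemma setY_triangle (T : Type) (A B C : set T) :
  A `+` C `<=` (A `+` B) `|` (B `+` C).
Proof.
move=> x; have [Bx|Bx] := pselect (B x); case=> -[? ?].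
- by right; left.
- by left; right.
- by left; left.
- by right; right.
Qed.

(** * The pseudometric of the symmetric difference *)

Section AlmostEqualSets.
Variables (R : realType) (d : measure_display) (Y : measurableType d).
Variable nu : probability Y R.
Implicit Types A B C : set Y.

(** The measurable cover [M] gives a meaning to the distance of arbitrary sets, such as fibres of a
    set measurable only for the completion. *)
Definition near_sets (e : R) A B :=
  exists M, [/\ measurable M, A `+` B `<=` M & pr nu M < e].

Lemma near_sets_sym e A B : near_sets e A B -> near_sets e B A.
Proof. by rewrite /near_sets setYC. Qed.

Lemma near_sets_trans e e' A B C :
  near_sets e A B -> near_sets e' B C -> near_sets (e + e') A C.
Proof.
move=> [M [mM AB Me]] [N [mN BC Ne]]; exists (M `|` N); split.
- exact: measurableU.
- exact: subset_trans (@setY_triangle _ A B C) (setUSS AB BC).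
- by apply: le_lt_trans (prU_le nu mM mN) _; exact: ltrD.
Qed.

Lemma near_sets_refl e A : 0 < e -> near_sets e A A.
Proof. by move=> e0; exists set0; split; rewrite ?setYK ?pr0. Qed.

Lemma infinitely_near_negligible A B :
  infinitely_near near_sets A B -> nu.-negligible (A `+` B).
Proof.
move=> /choice[M MP].
have mM n : measurable (M n) by case: (MP n).
have mI : measurable (\bigcap_n M n) by exact: bigcap_measurable.
apply: (@negligibleS _ _ _ _ (\bigcap_n M n)) => [x ABx n _|].
  by case: (MP n) => _ + _; apply.
apply/pr_eq0 => //; apply/eqP; rewrite eq_le pr_ge0 andbT.
apply/ler_addgt0Pl => e e0; rewrite addr0.
have [n] := ltr_add_invr e0; rewrite add0r => /ltW; apply: le_trans.
case: (MP n) => _ _ /ltW; apply: le_trans.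
by apply: pr_mono => // x; apply.
Qed.

Lemma negligible_bigcup_count (I : countType) (F : I -> set Y) :
  (forall i, nu.-negligible (F i)) -> nu.-negligible (\bigcup_i F i).
Proof.
move=> F0; rewrite bigcup_unpickle; apply: negligible_bigcup => n.
by case: unpickle => //=; exact: negligible_set0.
Qed.

Variables (G : groupType) (b : borel_action G Y).
Hypothesis b_mp : measure_preserving b nu.

Lemma near_sets_act g e A B : near_sets e A B ->
  near_sets e (b g @` A) (b g @` B).
Proof.
move=> [M [mM AB Me]]; exists (b g @` M); rewrite !act_image.
split; [exact: act_preimage_measurable| |by rewrite /pr b_mp].
by move=> y; exact: AB.
Qed.

End AlmostEqualSets.

(** * From chaining to weak mixing *)

Section WeakMixing.
Variables (R : realType) (r : nat).
Local Notation letter := (letter r.+1).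
Local Notation X := (boundary r.+1).
Local Notation beta := (boundary_action r).
Variables (pi : 'rV[R]_(r.+1 + r.+1)) (P : 'M[R]_(r.+1 + r.+1)).
Variable mu : probability X R.
Hypothesis mkv : markov_measure pi P mu.
Local Notation m := (pr mu).

(** Tonelli for a set [F] that is measurable only up to [N]: over [V] the fibres of [N] are null,
    hence so are those of the measurable version [S]. *)
Lemma negligible_sections d (Y : measurableType d) (nu : probability Y R)
    (F S N : set (X * Y)) (V : set X) :
  measurable S -> measurable N -> F `+` S `<=` N -> pr (mu \x nu)%E N = 0 ->
  measurable V -> m V = 1 ->
  (forall x, V x -> pr nu (xsection N x) = 0) ->
  (forall x, V x -> nu.-negligible [set y | F (x, y)]) ->
  (mu \x nu)%E.-negligible F.
Proof.
move=> mS mN FS N0 mV V1 VN VF.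
have S0 : pr (mu \x nu)%E S = 0.
  apply/pr_section0 => //; apply: (@pr_sub0 _ _ _ mu _ (~` V)).
  - exact: measurable_section_positive.
  - exact: measurableC.
  - move=> x /= Sx Vx; move/eqP: Sx; apply.
    apply/pr_eq0; first exact: measurable_xsection.
    have Nx := (pr_eq0 nu (measurable_xsection x mN)).1 (VN x Vx).
    apply: negligibleS (negligibleU (VF x Vx) Nx) => y /xsectionP Sxy.
    have [Fxy|Fxy] := pselect (F (x, y)); [by left|right].
    by apply/xsectionP; apply: FS; right.
  - by rewrite pr_setC// V1 subrr.
apply: negligibleS (negligibleU ((pr_eq0 _ mS).1 S0) ((pr_eq0 _ mN).1 N0)).
move=> z Fz; have [Sz|Sz] := pselect (S z); [by left|right].
by apply: FS; left.
Qed.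

(** The balls are centred at fibres of finitely determined approximations of [S]. By Markov's
    inequality the k-th one is off by e or more on a set of mass at most 1 / (k + 1), so almost
    every x is served by some k. *)
Lemma near_sections_cover d (Y : measurableType d) (nu : probability Y R)
    (E S N : set (X * Y)) e :
  measurable S -> measurable N -> E `+` S `<=` N -> pr (mu \x nu)%E N = 0 -> 0
    < e ->
  exists (I : countType) (z : I -> set Y) (A : I -> set X),
    [/\ forall i, measurable (A i),
        forall i x, A i x -> near_sets nu e (z i) [set y | E (x, y)]
      & m (~` \bigcup_i A i) = 0].
Proof.
move=> mS mN ES N0 e0.
have /choice[nB nBP] : forall k : nat, exists nB : nat * (seq letter -> set Y),
    (forall u, measurable (nB.2 u)) /\
    pr (mu \x nu)%E (S `+` prefix_set nB.1 nB.2) < e / k.+1%:R.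
  move=> k; have ek : 0 < e / k.+1%:R by rewrite divr_gt0.
  by have [n [B [mB SB]]] := product_approx mu nu mS ek; exists (n, B).
pose D k := prefix_set (nB k).1 (nB k).2.
have mD k : measurable (D k) by apply: measurable_prefix_set; case: (nBP k).
have mSD k : measurable (S `+` D k) by exact: measurableY.
pose bad k := [set x | e <= pr nu (xsection (S `+` D k) x)].
have mbad k : measurable (bad k) by exact: measurable_section_ge.
pose pos := [set x | pr nu (xsection N x) != 0].
have mpos : measurable pos by exact: measurable_section_positive.
pose A (i : nat * seq letter) : set X :=
  [set x : X | mkseq x (nB i.1).1 = i.2] `&` ~` bad i.1 `&` ~` pos.
have mA i : measurable (A i).
  apply: measurableI; last exact: measurableC.
  apply: measurableI; last exact: measurableC.
  by apply: (@measurable_determined _ (nB i.1).1) => x y /= <-.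
exists (nat * seq letter)%type, (fun i => (nB i.1).2 i.2), A; split=> //.
  move=> [k u] x [[/= xu xbad] xpos].
  exists (xsection (S `+` D k) x `|` xsection N x).
  have m1 := measurable_xsection x (mSD k); have m2 := measurable_xsection x mN.
  split; first exact: measurableU.
    move=> y Bfy; have [Nxy|Nxy] := pselect (N (x, y)).
      by right; apply/xsectionP.
    have ES' : E (x, y) <-> S (x, y).
      split=> h; apply: contrapT => h'; apply: Nxy; apply: ES; by [left|right].
    left; apply/xsectionP; move: Bfy; rewrite -xu => -[[By /= Exy]|[/= Exy By]].
      by right; split=> // /ES'.
    by left; split=> //; exact/ES'.
  apply: le_lt_trans (prU_le nu m1 m2) _.
  have -> : pr nu (xsection N x) = 0.
    by apply/eqP; apply: contra_notT xpos.
  by rewrite addr0 ltNge; exact/negP.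
have mbads : measurable (\bigcap_k bad k) by exact: bigcap_measurable.
apply: (@pr_sub0 _ _ _ mu _ (pos `|` \bigcap_k bad k)).
- by apply: measurableC; exact: measurable_bigcup_count.
- exact: measurableU.
- move=> x xA; have [px|px] := pselect (pos x); [by left|right] => k _.
  apply: contrapT => kx; apply: xA.
  by exists (k, mkseq x (nB k).1).
apply/eqP; rewrite eq_le pr_ge0 andbT.
apply: le_trans (prU_le mu mpos mbads) _.
rewrite (pr_section0 mu nu mN).1// add0r.
apply/ler_addgt0Pl => t t0; rewrite addr0.
have [k] := ltr_add_invr t0; rewrite add0r => /ltW; apply: le_trans.
have h1 : m (\bigcap_k bad k) <= m (bad k) by apply: pr_mono => // x; apply.
have h2 := pr_section_ge mu nu (mSD k) e0.
have [_ h3] := nBP k.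
have : e * m (bad k) <= e * k.+1%:R^-1 by apply: le_trans h2 (ltW h3).
by rewrite ler_pM2l// => /(le_trans h1).
Qed.

(** The fibres of an invariant set form an equivariant map, essentially constant with value [z0] up
    to null sets. Then [z0] is almost invariant, so ergodicity of [nu] makes it null or conull, and
    with it the invariant set. *)
Lemma chaining_weakly_mixing k : chaining beta mu k -> weakly_mixing beta mu.
Proof.
move=> ch d Y nu b _ b_mp b_erg E [S [mS [N [mN N0 ES]]]] invE.
have {}N0 : pr (mu \x nu)%E N = 0 by apply/pr_eq0 => //; apply/negligibleP.
have [[beta1 betaM] [b1 bM]] := (act_axiom beta, act_axiom b).
pose f x := [set y | E (x, y)].
have f_equiv g x : f (beta g x) = b g @` f x.
  have dE z : E z -> E (beta g z.1, b g z.2).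
    by move=> Ez; rewrite -(invE g); exists z.
  apply/seteqP; split=> [y|_ [y fxy <-]]; last exact: (dE (x, y)).
  rewrite /f /= -{1}(invE g) => -[[x' y'] Exy' [xx' yy']]; exists y' => //.
  have : beta g^-1%g (beta g x') = beta g^-1%g (beta g x) by congr (beta _ _).
  by rewrite !actVK => <-.
have [|V [mV V1 Vf]] := chaining_ess_const (@near_sets_sym _ _ _ nu)
  (@near_sets_trans _ _ _ nu) (near_sets_act b_mp) f_equiv ch.
  by move=> e e0; exact: near_sections_cover mS mN ES N0 e0.
pose pos := [set x | pr nu (xsection N x) != 0].
have mpos : measurable pos by exact: measurable_section_positive.
pose V' := V `&` ~` pos.
have mV' : measurable V' by apply: measurableI => //; exact: measurableC.
have V'1 : m V' = 1.
  have -> : V' = V `\` pos by [].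
  have := pr_split mu mV mpos; rewrite V1 (@pr_sub0 _ _ _ mu (V `&` pos) pos)
    ?addr0//.
  - exact: measurableI.
  - exact: (pr_section0 mu nu mN).1.
have V'N x : V' x -> pr nu (xsection N x) = 0.
  by move=> [_ xpos]; apply/eqP; apply: contra_notT xpos.
have [x0 V'x0] := pr1_ex V'1; have Vx0 : V x0 by case: V'x0.
pose z0 := f x0.
have inv_gen c : infinitely_near (near_sets nu) (b (fgen c) @` z0) z0.
  have [x [Vx Vcx]] := pr1_ex_gen mkv c mV V1.
  apply: (infinitely_near_trans (@near_sets_trans _ _ _ nu)) (Vf _ _ Vcx Vx0).
  rewrite f_equiv; apply: (infinitely_near_act (near_sets_act b_mp)).
  exact: Vf.
have inv_z0 g : infinitely_near (near_sets nu) (b g @` z0) z0.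
  rewrite -[g]gwordE; elim: (fword g) => [|c u IH] /=.
    have -> : b 1%g @` z0 = z0.
      by rewrite act_image; apply/seteqP; split=> y; rewrite /= invg1 b1.
    by move=> n; apply: near_sets_refl; rewrite invr_gt0.
  have -> : b (fgen c * gword u)%g @` z0 = b (fgen c) @` (b (gword u) @` z0).
    apply/seteqP; split=> [_ [y z0y <-]|_ [_ [y z0y <-] <-]].
      by exists (b (gword u) y); [exists y|rewrite bM].
    by exists y => //; rewrite bM.
  apply: (infinitely_near_trans (@near_sets_trans _ _ _ nu)) (inv_gen c).
  exact: (infinitely_near_act (near_sets_act b_mp)).
(* Ergodicity speaks of strictly invariant sets. [B] is the largest invariant subset of [z0], and
   only countably many null sets separate the two. *)
pose B := [set y | forall g, z0 (b g y)].
have Binv g : b g @` B = B.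
  rewrite act_image; apply/seteqP; split=> y By h; last first.
    by rewrite -bM; exact: By.
  by have := By (h * g)%g; rewrite -bM mulgK.
have z0B : nu.-negligible (z0 `+` B).
  apply: (@negligibleS _ _ _ _ (\bigcup_g (b g @` z0 `+` z0))); last first.
    apply: negligible_bigcup_count => g.
    exact: infinitely_near_negligible.
  move=> y [[z0y By]|[By nz0y]]; last first.
    by case: nz0y; have := By 1%g; rewrite b1.
  have /existsNP[g ngy] := By; exists g^-1%g => //; right; split=> //.
  by rewrite act_image /= invgK.
have mB : mu_measurable nu B.
  exists (xsection S x0); split; first exact: measurable_xsection.
  have Nx0 := (pr_eq0 nu (measurable_xsection x0 mN)).1 (V'N x0 V'x0).
  rewrite (setYC z0) in z0B.
  apply: negligibleS (negligibleU z0B Nx0) => y.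
  move=> /(@setY_triangle _ _ z0)[?|zS]; [by left|right].
  apply/xsectionP; apply: ES; case: zS => -[h1 h2].
    by left; split=> // h; apply: h2; apply/xsectionP.
  by right; split=> //; apply/xsectionP.
have near_z0 x : V' x -> nu.-negligible (f x `+` z0).
  by move=> [Vx _]; apply: infinitely_near_negligible; exact: Vf.
have [Bnull|Bfull] := b_erg B mB Binv; [left|right].
  apply: (negligible_sections mS mN ES N0 mV' V'1 V'N) => x V'x.
  apply: negligibleS (negligibleU (near_z0 x V'x) (negligibleU z0B Bnull)) => y
    fy.
  have [z0y|z0y] := pselect (z0 y); last by left; left.
  by right; have [By|By] := pselect (B y); [right|left; left].
(* Almost equality passes to complements, so the same argument serves the complement of [E]. *)
have ESC : ~` E `+` ~` S `<=` N.
  by move=> z [[Ez /contrapT Sz]|[Sz /contrapT Ez]]; apply: ES; [right|left].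
apply: (negligible_sections (measurableC mS) mN ESC N0 mV' V'1 V'N) => x V'x.
apply: negligibleS (negligibleU (near_z0 x V'x) (negligibleU z0B Bfull)) => y
  fy.
have [z0y|z0y] := pselect (z0 y); first by left; right.
by right; have [By|By] := pselect (B y); [left; right|right].
Qed.

End WeakMixing.

(** * Finite factors *)

(* The real field is recorded in the type so that the discrete metric can be
   a canonical instance. *)
Definition colour (R : realType) (r : nat) : Type := option (letter r.+1).

Section Colour.
Variables (R : realType) (r : nat).

HB.instance Definition _ := Finite.copy (colour R r) (option (letter r.+1)).
HB.instance Definition _ := isPointed.Build (colour R r) None.
HB.instance Definition _ := @isMeasurable.Build default_measure_display
  (colour R r) discrete_measurable discrete_measurable0
  discrete_measurableC discrete_measurableU.

Let dist (x y : colour R r) : R := (x != y)%:R.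

Let distxx x : dist x x = 0. Proof. by rewrite /dist eqxx. Qed.

Let dist_eq0 x y : dist x y = 0 -> x = y.
Proof.
by rewrite /dist; have [//|_] := eqVneq x y => /eqP; rewrite oner_eq0.
Qed.

Let dist_sym x y : dist x y = dist y x. Proof. by rewrite /dist eq_sym. Qed.

Let dist_triangle y x z : dist x z <= dist x y + dist y z.
Proof.
rewrite /dist; have [<-|xy] := eqVneq x y; first by rewrite add0r.
by rewrite -natrD ler_nat; case: (x != z).
Qed.

HB.instance Definition _ := isMetric.Build R (colour R r)
  distxx dist_eq0 dist_sym dist_triangle.

Lemma mdist_colour (x y : colour R r) : mdist x y = (x != y)%:R.
Proof. by []. Qed.

Lemma colour_measurable (A : set (colour R r)) : measurable A.
Proof. by []. Qed.

Lemma ball_colour (x : colour R r) : ball x 1 = [set x].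
Proof.
rewrite ballEmdist; apply/seteqP; split=> y /=; rewrite mdist_colour.
  by case: eqVneq => // _; rewrite ltxx.
by move=> ->; rewrite eqxx.
Qed.

Lemma colour_open (A : set (colour R r)) : open A.
Proof.
rewrite openE => x Ax; rewrite /interior -nbhs_ballE.
by exists 1 => //=; rewrite ball_colour => _ ->.
Qed.

Lemma colour_separable : separable (colour R r).
Proof.
exists setT; split; first exact: countableP.
by move=> U [x Ux] _; exists x.
Qed.

Lemma colour_complete : complete_metric (colour R r).
Proof.
move=> F FF /cauchyP /(_ 1 ltr01)[x]; rewrite ball_colour => Fx; exists x.
move=> A /nbhs_singleton Ax; apply: filterS Fx => _ ->; exact: Ax.
Qed.

Lemma colour_standard_borel : standard_borel R (colour R r).
Proof.
exists (colour R r), id; split.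
- exact: colour_complete.
- exact: colour_separable.
- by exists id.
- move=> A; rewrite image_id; split=> // _.
  by apply: sub_sigma_algebra; exact: colour_open.
Qed.

End Colour.

(** * Uniform measures on finite orbits *)

Section OrbitMeasure.
Variables (R : realType) (r : nat) (G : groupType).
Variables (b : borel_action G (colour R r)) (q : colour R r).

Let orb (x : colour R r) : bool := `[< exists g, b g q = x >].

Let orb_act g x : orb (b g x) = orb x.
Proof.
have [_ bM] := act_axiom b.
apply/asboolP/asboolP => -[h hx]; last by exists (g * h)%g; rewrite bM hx.
by exists (g^-1 * h)%g; rewrite bM hx actVK.
Qed.

(** [nu] is the normalised counting measure on the orbit of [q], which the group permutes. *)
Lemma orbit_measure : exists nu : probability (colour R r) R,
  measure_preserving b nu /\ forall A, nu A = 0%E <-> forall g, ~ A (b g q).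
Proof.
pose s := [seq x <- index_enum (colour R r) | orb x].
pose nu0 : {measure set (colour R r) -> \bar R} :=
  msum (fun i => dirac (nth q s i)) (size s).
pose w (A : set (colour R r)) : R := \sum_(x | orb x) (x \in A)%:R.
have nu0E A : nu0 A = (w A)%:E.
  transitivity (\sum_(k < size s) ((nth q s k \in A)%:R%:E : \bar R))%E.
    by apply: eq_bigr => k _; rewrite -diracE.
  rewrite sumEFin; congr EFin.
  rewrite -(big_mkord xpredT (fun i => (nth q s i \in A)%:R)).
  by rewrite -(big_nth q xpredT (fun x => (x \in A)%:R)) /s big_filter.
have w0 A : w A = 0 <-> forall g, ~ A (b g q).
  split=> [wA g Ag|nA].
    have orbg : orb (b g q) by apply/asboolP; exists g.
    move/eqP: wA; rewrite psumr_eq0// => /allP /(_ (b g q)).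
    by rewrite mem_index_enum orbg mem_set//= pnatr_eq0 => /(_ isT).
  rewrite /w big1// => x /asboolP[g <-].
  by rewrite memNset//; exact: nA.
have wT : w setT != 0.
  by apply/eqP => /w0 /(_ 1%g); apply.
pose nu : probability (colour R r) R := mnormalize nu0 (dirac q).
have nuE A : nu A = (w A / w setT)%:E.
  rewrite /nu /= /mnormalize; case: ifPn => [|_].
    by rewrite !nu0E /= eqe (negbTE wT).
  by rewrite !nu0E /= EFinM.
exists nu; split=> [g A _|A].
  suff : nu (b g @^-1` A) = nu A by [].
  rewrite !nuE; congr (_ / _)%:E; rewrite /w.
  have bI : injective (b g) by move=> x y /(congr1 (b g^-1%g)); rewrite !actVK.
  rewrite [RHS](reindex_inj bI) /=; apply: eq_big => x;
    first by rewrite orb_act.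
  by move=> _; congr (_%:R); apply/idP/idP; rewrite !inE.
rewrite nuE -w0; split=> [[/eqP]|->]; last by rewrite mul0r.
by rewrite mulf_eq0 invr_eq0 (negbTE wT) orbF => /eqP.
Qed.

End OrbitMeasure.

(** * What a finite factor excludes *)

Section FiniteFactor.
Variables (R : realType) (r : nat).
Local Notation X := (boundary r.+1).
Local Notation beta := (boundary_action r).
Variable mu : probability X R.
Local Notation m := (pr mu).

Definition finite_factor :=
  exists (rho : borel_action (free_group r.+1) (colour R r))
         (f : X -> colour R r) (q q' : colour R r),
    [/\ forall g x, f (beta g x) = rho g (f x),
        forall p, measurable (f @^-1` [set p]), q != q',
        0 < m (f @^-1` [set q]) & 0 < m (f @^-1` [set q'])].

Hypothesis fact : finite_factor.

(** The graph of [f] is invariant in the product with the orbit of q. It contains f^-1(q) x {q} and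
    its complement contains f^-1(q') x {q}, both of positive mass. *)
Lemma finite_factor_not_weakly_mixing : ~ weakly_mixing beta mu.
Proof.
have [rho [f [q [q' [f_equiv mf qq' q0 q'0]]]]] := fact.
have [nu [nu_mp nu0]] := orbit_measure rho q.
move=> /(_ _ _ nu rho (colour_standard_borel R r) nu_mp).
have nuq : nu [set q] != 0%E.
  by apply/eqP => /nu0 /(_ 1%g); rewrite (act_axiom rho).1; apply.
have erg : ergodic rho nu.
  move=> A _ invA; have [[g Ag]|nA] := pselect (exists g, A (rho g q)).
    right; apply/negligibleP; first exact: colour_measurable.
    apply/nu0 => h; apply; rewrite -(invA (h * g^-1)%g).
    by exists (rho g q) => //; rewrite -(act_axiom rho).2 mulgVK.
  left; apply/negligibleP; first exact: colour_measurable.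
  by apply/nu0 => g Ag; apply: nA; exists g.
move=> /(_ erg); set E := [set z : X * colour R r | f z.1 = z.2].
have mE : measurable E.
  have -> : E = \bigcup_(p in [set: colour R r]) ((f @^-1` [set p]) `*` [set
    p]).
    by apply/seteqP; split=> [[x p] xp|[x p] [p' _ [/= fx px]]];
      [by exists p|by rewrite /E /= fx px].
  by apply: fin_bigcup_measurable => // p _; exact: measurableX.
have invE g : diagonal_action beta rho g @` E = E.
  rewrite act_image; apply/seteqP; split=> -[x p]; rewrite /E /=.
    rewrite -[bact _ _]/(beta g^-1%g x) f_equiv.
    by move=> /(congr1 (rho g)); rewrite !actKV.
  by move=> <-; rewrite -[bact _ _]/(beta g^-1%g x) f_equiv.
have rect p (F : set (X * colour R r)) : 0 < m (f @^-1` [set p]) ->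
    (f @^-1` [set p]) `*` [set q] `<=` F -> (mu \x nu)%E.-negligible F -> False.
  move=> p0 sub nF; have mR := measurableX (mf p) (colour_measurable [set q]).
  have R0 : (mu \x nu)%E ((f @^-1` [set p]) `*` [set q]) = 0%E.
    exact: (negligibleP (mu \x nu)%E mR).1 (negligibleS sub nF).
  move: R0; rewrite product_measure1E// => /eqP;
    rewrite mule_eq0 (negbTE nuq) orbF => /eqP mu0.
  by move: p0; rewrite /pr mu0 ltxx.
move=> /(_ E); case => //.
- exists E; split=> //; rewrite setYK; exact: negligible_set0.
- by apply: (rect q) => // -[x p] [/= fx px]; rewrite /E /= fx px.
- by apply: (rect q') => // -[x p] [/= fx px]; rewrite /E /= fx px; apply/eqP;
  rewrite eq_sym.
Qed.

(** Consecutive translates share a point, so all colours g_i p equal g_0 p = p. *)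
Lemma chains_factor (M : {measure set X -> \bar R}) k A B
    (rho : borel_action (free_group r.+1) (colour R r)) (f : X -> colour R r) p
      p' :
  (forall g x, f (beta g x) = rho g (f x)) ->
  A `<=` f @^-1` [set p] -> B `<=` f @^-1` [set p'] -> chains beta M k A B -> p
    = p'.
Proof.
move=> f_equiv Ap Bp' [g [g0 gA gB]].
have meet (C : set X) : (0 < M C)%E -> exists x, C x.
  by have [->|/set0P//] := eqVneq C set0; rewrite measure0 ltxx.
have fg i x : (beta (g i) @` A) x -> f x = rho (g i) p.
  by move=> [y /Ap fy <-]; rewrite f_equiv fy.
have gp i : (i <= k)%N -> rho (g i) p = p.
  elim: i => [_|i IH ik]; first by rewrite g0 (act_axiom rho).1.
  have [x [xi xi1]] := meet _ (gA i ik).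
  by rewrite -(fg _ _ xi1) (fg _ _ xi) IH// ltnW.
have [x [xk /Bp' /= fx]] := meet _ gB.
by rewrite -fx (fg _ _ xk) gp.
Qed.

Lemma finite_factor_not_chaining k : ~ chaining beta mu k.
Proof.
have [rho [f [q [q' [f_equiv mf qq' q0 q'0]]]]] := fact.
move=> /(_ (f @^-1` [set q]) (f @^-1` [set q'])).
rewrite !pr_gt0// => /(_ (mf _) (mf _) (@subsetT _ _) (@subsetT _ _) q0 q'0).
by move=> /(chains_factor f_equiv (@subset_refl _ _) (@subset_refl _ _))/eqP;
  apply/negP.
Qed.

Variable gamma : nat -> free_group r.+1.
Hypothesis gammaP : forall g, exists n, gamma n = g.
Let mt : probability X R := nonsingularization beta mu gamma.

(** The group permutes the colours, hence acts by isometries of the discrete metric. *)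
Lemma finite_factor_not_metrically_ergodic : ~ metrically_ergodic beta mt.
Proof.
have [rho [f [q [q' [f_equiv mf qq' q0 q'0]]]]] := fact.
move=> /(_ (colour R r) rho (@colour_separable _ _) (act_axiom rho)).
have iso g z1 z2 : mdist (rho g z1) (rho g z2) = mdist z1 z2.
  rewrite !mdist_colour; congr (~~ _)%:R; apply/eqP/eqP => [|->//].
  by move=> /(congr1 (rho g^-1%g)); rewrite !actVK.
move=> /(_ iso f); case=> //.
  move=> B _; exists (f @^-1` B); split; last by rewrite setYK;
    exact: negligible_set0.
  have -> : f @^-1` B = \bigcup_(p in B) (f @^-1` [set p]).
    by apply/seteqP; split=> [x Bx|x [p Bp fx]];
      [exists (f x)|rewrite /preimage /= fx].
  by apply: fin_bigcup_measurable => //; exact: finite_finset.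
move=> z nz.
have pz p : 0 < m (f @^-1` [set p]) -> p = z.
  move=> p0; apply: contrapT => pz.
  have := nonsingularization_gt0 beta gammaP (mf p) p0.
  have /(negligibleP mt (mf p)) : mt.-negligible (f @^-1` [set p]).
    by apply: negligibleS nz => x /= -> /pz.
  by rewrite /mt => ->; rewrite ltxx.
by move/eqP: qq'; rewrite (pz q q0) (pz q' q'0).
Qed.

Lemma pr_translate0 g A : measurable A -> pr mt A = 0 -> pr mt (beta g @` A) =
  0.
Proof.
move=> mA A0; have mgA : measurable (beta g @` A) by exact:
  act_image_measurable.
have {}A0 : mt A = 0%E by rewrite prE// A0.
rewrite /pr (_ : mt _ = 0%E)//; apply/(nonsingularization_eq0 _ _ gammaP) => //
  h.
have := (nonsingularization_eq0 _ _ gammaP mA).1 A0 (g^-1 * h)%g.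
congr (m _ = 0); rewrite act_image; apply/seteqP.
by split=> x; rewrite /preimage /= -bactM.
Qed.

(** Chaining on W puts W over a single colour p0, up to a null set. Every g with gW meeting W in
    positive mass then fixes p0, and so does the group they generate. The translates of W thus lie
    over p0 as well, and they are conull, which leaves no room for a second fibre. *)
Lemma finite_factor_not_essentially_chaining k : ~ essentially_chaining beta mt
  k.
Proof.
have [rho [f [q [q' [f_equiv mf qq' q0 q'0]]]]] := fact.
move=> [W [mW ch satW genW]].
have mWf p : measurable (W `&` f @^-1` [set p]) by exact: measurableI.
have mgW g : measurable (beta g @` W) by exact: act_image_measurable.
have satW0 : pr mt (~` \bigcup_g beta g @` W) = 0.
  apply/pr_eq0 => //; apply: measurableC; exact: measurable_bigcup_count.
have [p0 Wp0] : exists p, 0 < pr mt (W `&` f @^-1` [set p]).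
  apply: contrapT => /forallNP W0.
  have W00 : pr mt W = 0.
    have -> : W = \bigcup_p (W `&` f @^-1` [set p]).
      by apply/seteqP; split=> [x Wx|x [p _ []]//]; exists (f x).
    apply: pr_bigcup_count0 => // p; apply/eqP;
      rewrite eq_le pr_ge0 andbT leNgt.
    exact/negP/W0.
  have := prT mt; rewrite (@pr_split _ _ _ mt setT (\bigcup_g beta g @` W))//;
    last first.
    exact: measurable_bigcup_count.
  rewrite setTD setTI satW0 add0r pr_bigcup_count0// => [/esym/eqP|g].
    by rewrite oner_eq0.
  exact: pr_translate0.
have Wp p : p != p0 -> pr mt (W `&` f @^-1` [set p]) = 0.
  move=> pp0; apply/eqP; rewrite eq_le pr_ge0 andbT leNgt; apply/negP => Wp.
  move/eqP: pp0; apply; apply/esym.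
  apply: (@chains_factor mt k (W `&` f @^-1` [set p0]) (W `&` f @^-1` [set p])
    rho f) => //.
  by apply: ch => //; rewrite pr_gt0.
pose W1 := W `\` f @^-1` [set p0].
have mW1 : measurable W1 by exact: measurableD.
have W10 : pr mt W1 = 0.
  have -> : W1 = \bigcup_p (if p == p0 then set0 else W `&` f @^-1` [set p]).
    apply/seteqP; split=> [x [Wx fx]|x [p _]].
      by exists (f x) => //; case: eqP.
    by case: eqP => // pp0 [Wx /= fx]; split=> //; rewrite /= fx.
  apply: pr_bigcup_count0 => p; first by case: ifP.
  by case: eqP => [_|/eqP]; [exact: pr0|exact: Wp].
have fixp0 g : rho g p0 = p0.
  pose H : {pred free_group r.+1} := fun g => `[< rho g p0 = p0 >].
  have [rho1 rhoM] := act_axiom rho.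
  suff : g \in H by move=> /asboolP.
  apply: genW => [|h /= Wh].
    split; first exact/asboolP.
    move=> h h' /asboolP hp /asboolP hp'; apply/asboolP.
    by rewrite rhoM -{1}hp' actVK.
  apply/asboolP; apply: contrapT => hp0.
  have mh : measurable (beta h @` W `&` W) by exact: measurableI.
  move: Wh; rewrite pr_gt0// (@pr_sub0 _ _ _ mt _ (beta h @` W1 `|` W1))
    ?ltxx//.
  - by apply: measurableU => //; exact: act_image_measurable.
  - move=> x [[y Wy yx] Wx].
    have [fx|fx] := eqVneq (f x) p0; last by right; split=> //; exact/eqP.
    left; exists y => //; split=> //= fy; apply: hp0.
    by rewrite -[RHS]fx -yx f_equiv fy.
  - apply/eqP; rewrite eq_le pr_ge0 andbT.
    apply: le_trans (prU_le mt (act_image_measurable beta h mW1) mW1) _.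
    by rewrite pr_translate0// W10 addr0.
have [p [pp0 fp]] : exists p, p != p0 /\ 0 < m (f @^-1` [set p]).
  have [qp0|qp0] := eqVneq q p0; last by exists q.
  by exists q'; split=> //; rewrite -qp0 eq_sym.
have := nonsingularization_gt0 beta gammaP (mf p) fp; rewrite -/(mt _) pr_gt0//.
rewrite (@pr_sub0 _ _ _ mt _
  (~` (\bigcup_g beta g @` W) `|` \bigcup_g beta g @` W1)) ?ltxx//.
- apply: measurableU; first by apply: measurableC;
  exact: measurable_bigcup_count.
  by apply: measurable_bigcup_count => g; exact: act_image_measurable.
- move=> x /= fx; have [[g _ [w Ww wx]]|] := pselect ((\bigcup_g beta g @` W)
  x); last by left.
  right; exists g => //; exists w => //; split=> //= fw.
  by move/eqP: pp0; apply; rewrite -fx -wx f_equiv fw.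
- apply/eqP; rewrite eq_le pr_ge0 andbT; apply: le_trans (prU_le mt _ _) _.
  + by apply: measurableC; exact: measurable_bigcup_count.
  + by apply: measurable_bigcup_count => g; exact: act_image_measurable.
  rewrite satW0 add0r pr_bigcup_count0// => g;
    first exact: act_image_measurable.
  exact: pr_translate0.
Qed.

End FiniteFactor.

(** * Factors from the failure of strict irreducibility *)

Section FactorConstruction.
Variables (R : realType) (r : nat).
Local Notation letter := (letter r.+1).
Local Notation X := (boundary r.+1).
Local Notation beta := (boundary_action r).
Variables (pi : 'rV[R]_(r.+1 + r.+1)) (P : 'M[R]_(r.+1 + r.+1)).
Variable mu : probability X R.
Hypothesis mkv : markov_measure pi P mu.
Implicit Types (a b c : letter) (u w : seq letter) (x y : X) (A B E : set X).
Local Notation m := (pr mu).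
Local Notation edge := (edge P).
Local Notation overlap := (overlap P).
Local Notation W := (@admissible R r P).

Lemma pr_fibre_gt0 (T : Type) (f : X -> T) p c : measurable (f @^-1` [set p]) ->
  (forall x, W x -> x 0%N = c -> f x = p) -> 0 < m (f @^-1` [set p]).
Proof.
move=> mf fp; apply: lt_le_trans (init_gt0 mkv c) _;
  rewrite -(pr_admissible_cyl1 mkv).
apply: pr_mono => // [|x [Wx [xc _]]]; last exact: fp.
by apply: measurableI; [exact: measurable_admissible|exact: measurable_cyl].
Qed.

Lemma equivariant_gen (T : Type) (rho : free_group r.+1 -> T -> T) (f : X -> T)
  :
  group_action rho ->
  (forall c x, f (bcons c x) = rho (fgen c) (f x)) ->
  forall g x, f (beta g x) = rho g (f x).
Proof.
move=> [rho1 rhoM] f_gen g x; rewrite -[g]gwordE.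
elim: (fword g) => [|c u IH]; first by rewrite rho1.
by rewrite beta_gword_cons f_gen IH -rhoM.
Qed.

Section Reducible.
Variable v : 'rV[R]_(r.+1 + r.+1).
Hypotheses (v_stat : stationary_distribution P v) (v_gt0 : positive_vector v).
Variable C : {pred letter}.
Hypothesis C_closed : forall a b, a \in C -> edge a b -> b \in C.

(* By stationarity a closed class receives no mass from its complement. *)
Lemma closed_backward a b : edge a b -> b \in C -> a \in C.
Proof.
move=> ab bC; apply: contraT => aC.
have vP c : v 0 c = \sum_d v 0 d * P d c.
  by have [_ /matrixP/(_ 0 c)] := v_stat; rewrite mxE => <-.
have inC d : d \in C -> \sum_(c in C) P d c = 1.
  move=> dC; rewrite -(P_sum mkv d) [RHS](bigID (mem C)) /= [X in _ + X]big1
    ?addr0//.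
  by move=> c cC; apply: (edgePn mkv); apply: contra cC; exact: C_closed.
have : \sum_(c in C) v 0 c = \sum_d v 0 d * \sum_(c in C) P d c.
  under eq_bigr do rewrite vP.
  by rewrite exchange_big; apply: eq_bigr => d _; rewrite mulr_sumr.
rewrite [RHS](bigID (mem C)) /= => /eqP.
under [X in _ == X + _]eq_bigr => d dC do rewrite inC// mulr1.
rewrite -subr_eq0 opprD addrA subrr sub0r oppr_eq0 => /eqP sum0.
have : 0 < \sum_(d | d \notin C) v 0 d * \sum_(c in C) P d c.
  have P0 d : 0 <= \sum_(c in C) P d c.
    by rewrite sumr_ge0// => c _; exact: P_ge0 mkv _ _.
  rewrite (bigD1 a)//=; apply: ltr_pwDl; last first.
    by rewrite sumr_ge0// => d _; rewrite mulr_ge0// ltW.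
  apply: mulr_gt0 => //; rewrite (bigD1 b)//=; apply: ltr_pwDl => //.
  by rewrite sumr_ge0// => c _; exact: P_ge0 mkv _ _.
by rewrite sum0 ltxx.
Qed.

(** Adding or cancelling a letter leaves the tail alone, so the trivial action on colours will do.
    An admissible sequence neither leaves [C] nor, by [closed_backward], enters it, so its first
    letter decides the colour. *)
Lemma reducible_factor a a' : a \in C -> a' \notin C -> finite_factor mu.
Proof.
move=> aC a'C.
pose ev x := exists n, forall i, (n <= i)%N -> x i \in C.
have ev_gen c x : ev x -> ev (bcons c x).
  move=> [n xn]; have [xc|xc] := eqVneq (x 0%N) (linv c).
    exists n => i ni; rewrite -(linvK c) bcons_shift//; apply: xn.
    exact: leqW.
  by exists n.+1 => -[//|i] ni; rewrite bcons_cons//; exact: xn.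
have evE c x : ev (bcons c x) <-> ev x.
  split; last exact: ev_gen.
  by move=> /(ev_gen (linv c)); have := bconsK (linv c) x; rewrite linvK => ->.
have mev : measurable [set x | ev x].
  have -> : [set x | ev x] = \bigcup_n \bigcap_i [set x : X | (n <= i)%N -> x i
    \in C].
    apply/seteqP; split=> [x [n xn]|x [n _ xn]]; first by exists n => // i _;
      exact: xn.
    by exists n => i; exact: xn.
  apply: bigcup_measurable => n _; apply: bigcap_measurable => // i _.
  apply: (@measurable_determined _ i.+1) => x y xy /= xi ni;
    rewrite -(mkseq_coord xy (ltnSn i)).
  exact: xi.
pose f x : colour R r := if `[< ev x >] then None else Some a.
have triv : group_action (fun (g : free_group r.+1) (p : colour R r) => p) by
  [].
exists (BorelAction triv (fun=> @measurable_id _ _ _)), f, None, (Some a).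
have mf p : measurable (f @^-1` [set p]).
  have -> : f @^-1` [set p] = ([set x | ev x] `&` [set _ | None = p :> colour R
    r]) `|`
      (~` [set x | ev x] `&` [set _ | Some a = p :> colour R r]).
    apply/seteqP; split=> x; rewrite /f /=; case: asboolP => h.
    - by left.
    - by right.
    - by case=> [[]|[]].
    - by case=> [[]|[]].
  have mc (Q : Prop) : measurable [set _ : X | Q].
    have [q|q] := pselect Q.
      by rewrite (_ : [set _ | Q] = setT)//; apply/seteqP; split.
    by rewrite (_ : [set _ | Q] = set0)//; apply/seteqP; split.
  by apply: measurableU; apply: measurableI => //; exact: measurableC.
split=> //.
- apply: equivariant_gen => // c x.
  by rewrite /f; congr (if _ then _ else _); apply/asboolP/asboolP => /evE.
- apply: (@pr_fibre_gt0 _ _ _ a) => // x Wx xa; rewrite /f asboolT//.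
  exists 0%N => i _; elim: i => [|i IH]; first by rewrite xa.
  exact: C_closed IH (Wx i).
- apply: (@pr_fibre_gt0 _ _ _ a') => // x Wx xa; rewrite /f asboolF//.
  have nC i : x i \notin C.
    elim: i => [|i IH]; first by rewrite xa.
    by apply: contra IH; exact: closed_backward (Wx i).
  by move=> [n /(_ n (leqnn n))]; exact/negP.
Qed.

End Reducible.

Section TranspositionFactor.
Variables s t : letter -> letter.
Hypotheses (s_linv : forall c, s (linv c) = s c).
Hypotheses (t_linv : forall c, t (linv c) = t c).
Hypothesis s_edge : forall a b, edge a b -> s b = t a.

Let tp c : {perm letter} := tperm (s c) (t c).

Let tp_linv c : tp (linv c) = tp c.
Proof. by rewrite /tp s_linv t_linv. Qed.

(** Letters serve as names of classes. As c and c^-1 give the same transposition, an involution,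
    cancellation is respected. *)
Definition colour_act (g : free_group r.+1) (p : colour R r) : colour R r :=
  omap (fun a => foldr (fun c => tp c) a (fword g)) p.

Lemma colour_act_action : group_action colour_act.
Proof.
split=> [[]//|g h [a|//]]; congr Some; rewrite /= /red_cat.
elim: (fword g) => [//|c u /= <-].
case: (foldr _ _ u) => [//|b w] /=; case: ifP => // /eqP ->.
by rewrite tp_linv tpermK.
Qed.

Fixpoint tail_colour n x : letter :=
  if n is k.+1 then tp (x 0%N) (tail_colour k (bshift x)) else s (x 0%N).

(** Only the steps from n on count: having some such n is an invariant property, unlike
    [admissible]. *)
Definition tail_admissible n x := forall i, (n <= i)%N -> edge (x i) (x i.+1).

(** By [s_edge], s(x_(n+1)) = t(x_n), which the transposition of x_n takes to s(x_n). *)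
Lemma tail_colourS n x : tail_admissible n x -> tail_colour n.+1 x =
  tail_colour n x.
Proof.
elim: n x => [|n IH] x adm.
  by rewrite /= (s_edge (adm 0%N isT)) tpermR.
rewrite [LHS]/= -[tp (bshift x 0%N) _]/(tail_colour n.+1 (bshift x)) IH//.
by move=> i ni; exact: (adm i.+1).
Qed.

Lemma tail_colour_leq n k x : tail_admissible n x -> (n <= k)%N ->
  tail_colour k x = tail_colour n x.
Proof.
move=> adm; elim: k => [|k IH]; first by rewrite leqn0 => /eqP ->.
rewrite leq_eqVlt => /predU1P[<-//|]; rewrite ltnS => nk.
rewrite tail_colourS ?IH// => i ki; apply: adm; exact: leq_trans ki.
Qed.

Lemma tail_colour_determined n x y : mkseq x n.+1 = mkseq y n.+1 ->
  tail_colour n x = tail_colour n y.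
Proof.
move=> /mkseq_coord; elim: n x y => [|n IH] x y xy /=;
  first by rewrite (xy 0%N).
by rewrite (xy 0%N)//; congr (tp _ _); apply: IH => i ni; exact: (xy i.+1).
Qed.

(** By [tail_colour_leq] the n picked by [cid] does not matter. *)
Definition boundary_colour x : colour R r :=
  if pselect (exists n, tail_admissible n x) is left h
  then Some (tail_colour (projT1 (cid h)) x) else None.

Lemma boundary_colourE n x : tail_admissible n x ->
  boundary_colour x = Some (tail_colour n x).
Proof.
move=> adm; rewrite /boundary_colour; case: pselect => [h|[]]; last by exists n.
case: (cid h) => k admk /=; congr Some.
by have [nk|/ltnW kn] := leqP n k; [|symmetry]; exact: tail_colour_leq.
Qed.

Lemma boundary_colour_None x : ~ (exists n, tail_admissible n x) ->
  boundary_colour x = None.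
Proof. by rewrite /boundary_colour; case: pselect. Qed.

(** If [c] is put in front, one more transposition is applied. If it cancels x_0 = c^-1, the first
    transposition is removed, which amounts to applying it once more. The index n+1 suits both
    cases. *)
Lemma tail_admissible_gen c n x : tail_admissible n x ->
  tail_admissible n.+1 (bcons c x) /\
  tail_colour n.+1 (bcons c x) = tp c (tail_colour n x).
Proof.
move=> adm; have [xc|xc] := eqVneq (x 0%N) (linv c).
  have -> : bcons c x = bshift x by rewrite -(linvK c) bcons_shift.
  split=> [i ni|]; first by apply: (adm i.+1); apply/leqW/ltnW.
  have admS : tail_admissible n (bshift x).
    by move=> i ni; apply: (adm i.+1); exact: leqW.
  rewrite (tail_colourS admS) -(tail_colourS adm) /= xc tp_linv.
  by rewrite /tp tpermK.
split=> [[//|i] ni|]; first by rewrite !bcons_cons//; exact: adm.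
by rewrite /= -/(bcons c x) bshift_bcons// -[bcons_seq _ _ _]/(bcons c x 0%N)
  bcons_cons.
Qed.

Lemma boundary_colour_gen c x :
  boundary_colour (bcons c x) = colour_act (fgen c) (boundary_colour x).
Proof.
have [[n adm]|nadm] := pselect (exists n, tail_admissible n x).
  have [admS colS] := tail_admissible_gen c adm.
  by rewrite (boundary_colourE adm) (boundary_colourE admS) colS.
rewrite !boundary_colour_None// => -[n adm]; apply: nadm; exists n.+1.
have [+ _] := tail_admissible_gen (linv c) adm.
by have := bconsK (linv c) x; rewrite linvK => ->.
Qed.

Lemma boundary_colour_measurable p : measurable (boundary_colour @^-1` [set p]).
Proof.
have madm n : measurable [set x | tail_admissible n x].
  have -> : [set x | tail_admissible n x] =
      \bigcap_i [set x : X | (n <= i)%N -> edge (x i) (x i.+1)].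
    by apply/seteqP; split=> [x xn i _|x xn i]; [exact: xn|exact: (xn i)].
  apply: bigcap_measurable => // i _.
  apply: (@measurable_determined _ i.+2) => x y xy /= xi ni.
  by rewrite -!(mkseq_coord xy)//; exact: xi.
have mcol n a : measurable [set x | tail_colour n x = a].
  apply: (@measurable_determined _ n.+1) => x y xy /= <-.
  exact/esym/tail_colour_determined.
case: p => [a|].
  have -> : boundary_colour @^-1` [set Some a] =
      \bigcup_n ([set x | tail_admissible n x] `&` [set x | tail_colour n x =
        a]).
    apply/seteqP; split=> [x|x [n _ [/= adm xa]]]; last first.
      by rewrite /preimage /= (boundary_colourE adm) xa.
    have [[n adm]|nadm] := pselect (exists n, tail_admissible n x).
      by rewrite /preimage /= (boundary_colourE adm) => -[xa]; exists n.
    by rewrite /preimage /= boundary_colour_None.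
  by apply: bigcup_measurable => n _; exact: measurableI.
have -> : boundary_colour @^-1` [set None] = ~` \bigcup_n [set x |
  tail_admissible n x].
  apply/seteqP; split=> [x xN [n _ adm]|x xn].
    by move: xN; rewrite /preimage /= (boundary_colourE adm).
  by apply: boundary_colour_None => -[n adm]; apply: xn; exists n.
by apply: measurableC; exact: bigcup_measurable.
Qed.

Lemma transposition_factor c d : s c != s d -> finite_factor mu.
Proof.
move=> cd.
exists (BorelAction colour_act_action (fun _ _ _ _ => @colour_measurable _ _
  _)).
exists boundary_colour, (Some (s c)), (Some (s d)).
have col0 b x : W x -> x 0%N = b -> boundary_colour x = Some (s b).
  by move=> Wx <-; rewrite (@boundary_colourE 0%N)// => i _; exact: Wx.
split.
- exact: equivariant_gen colour_act_action boundary_colour_gen.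
- exact: boundary_colour_measurable.
- by apply: contra cd => /eqP[->].
- exact: pr_fibre_gt0 (boundary_colour_measurable _) (col0 c).
- exact: pr_fibre_gt0 (boundary_colour_measurable _) (col0 d).
Qed.

End TranspositionFactor.

Hypothesis wis : weakly_inverse_symmetric P.

(** Any two predecessors of a letter overlap, so the class of the chosen predecessor [pd] is that of
    every other one. A predecessor of e other than e and e^-1 also precedes e^-1, which gives
    s(e^-1) = s(e). *)
Lemma irreducible_factor : (forall a b, connect edge a b) ->
  ~ (forall a b, connect overlap a b) -> finite_factor mu.
Proof.
move=> conn /existsNP[a /existsNP[b /negP nab]].
have csym := sym_connect_sym (overlap_sym P).
pose rt := fingraph.root overlap.
have rtE c d : (rt c == rt d) = connect overlap c d by exact: root_connect.
have /choice[pd pdP] := ex_pred mkv conn.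
have s_edge c d : edge c d -> rt (pd d) = rt c.
  move=> cd; apply/eqP; rewrite rtE; apply: connect1.
  by have [_ _ pdd] := pdP d; exact: overlapI pdd cd.
(* The predecessors a of [c] and b of [d] lie in different classes, so s(c) and s(d) differ. *)
have [c ac] := ex_edge mkv a; have [d bd] := ex_edge mkv b.
apply: (@transposition_factor (rt \o pd) rt _ _ _ c d) => //=.
- move=> e; apply: s_edge; have [ep epV pe] := pdP e.
  have [_ h _] := edge_linv mkv wis ep epV pe.
  apply: h.
- by move=> e; apply/eqP; rewrite rtE csym;
  apply/connect1/(overlap_linv mkv wis).
- by rewrite (s_edge _ _ ac) (s_edge _ _ bd) rtE.
Qed.

End FactorConstruction.

(** * The equivalence *)

Lemma strictly_irreducible_or_factor (R : realType) (r : nat)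
    (pi : 'rV[R]_(r.+1 + r.+1)) (P : 'M[R]_(r.+1 + r.+1))
    (mu : probability (boundary r.+1) R) :
  markov_measure pi P mu ->
  (exists v : 'rV[R]_(r.+1 + r.+1),
      stationary_distribution P v /\ positive_vector v) ->
  weakly_inverse_symmetric P -> ~ finite_factor mu -> strictly_irreducible P.
Proof.
move=> mkv [v [v_stat v_gt0]] wis nofactor; apply/(strictly_irreducibleP mkv).
have irr a b : exists2 c, edge P a c & connect (edge P) c b.
  apply: contrapT => nab; apply: nofactor.
  (* The letters reached from a in at least one step form a closed class, which misses b. *)
  pose C : {pred letter r.+1} :=
    fun d => [exists c, edge P a c && connect (edge P) c d].
  have [c ac] := ex_edge mkv a.
  apply: (reducible_factor mkv v_stat v_gt0 (C := C) _ (a := c) (a' := b)).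
  - move=> d e /existsP[c' /andP[ac' c'd]] de; apply/existsP; exists c'.
    by rewrite ac' (connect_trans c'd (connect1 de)).
  - by apply/existsP; exists c; rewrite ac connect0.
  - apply/negP => /existsP[c' /andP[ac' c'b]]; apply: nab; by exists c'.
have conn a b : connect (edge P) a b.
  by have [c ac cb] := irr a b; exact: connect_trans (connect1 ac) cb.
split=> //; apply: contrapT => noverlap; apply: nofactor.
exact: irreducible_factor mkv wis conn noverlap.
Qed.

Theorem theorem6p6 (R : realType) (r : nat)
    (pi : 'rV[R]_(r.+1 + r.+1)) (P : 'M[R]_(r.+1 + r.+1))
    (mu : probability (boundary r.+1) R)
    (gamma : nat -> free_group r.+1) :
  markov_measure pi P mu ->
  (exists v : 'rV[R]_(r.+1 + r.+1),
      stationary_distribution P v /\ positive_vector v) ->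
  weakly_inverse_symmetric P ->
  (forall g : free_group r.+1, exists n, gamma n = g) ->
  let beta := boundary_action r in
  let mu_tilde : probability (boundary r.+1) R :=
    nonsingularization beta mu gamma in
  [<-> weakly_mixing beta mu;
       metrically_ergodic beta mu_tilde;
       boundedly_chaining beta mu;
       essentially_chaining beta mu_tilde #|letter r.+1|.-1;
       chaining beta mu #|letter r.+1|.-1;
       strictly_irreducible P].
Proof.
move=> mkv stat wis gammaP beta mu_tilde.
have irr_ch : strictly_irreducible P -> chaining beta mu #|letter r.+1|.-1.
  move=> /(strictly_irreducibleP mkv)[irr ov].
  apply: (strictly_irreducible_chaining mkv wis) => // a b.
  by have [c ac cb] := irr a b; exact: connect_trans (connect1 ac) cb.
(* The first four implications go through this: the condition excludes finite factors, and their
   absence gives chaining of length |S| - 1. *)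
have nofactor : ~ finite_factor mu -> chaining beta mu #|letter r.+1|.-1.
  by move=> nf; apply/irr_ch/(strictly_irreducible_or_factor mkv stat wis nf).
tfae.
- move=> wm; apply: (chaining_metrically_ergodic mkv gammaP).
  by apply: nofactor => /finite_factor_not_weakly_mixing; apply.
- move=> me; exists #|letter r.+1|.-1; apply: nofactor => fact.
  exact: (finite_factor_not_metrically_ergodic fact gammaP).
- move=> [k ch]; apply: (chaining_essentially mkv gammaP);
  apply: nofactor => fact.
  exact: finite_factor_not_chaining ch.
- move=> ech; apply: nofactor => fact.
  exact: (finite_factor_not_essentially_chaining fact gammaP ech).
- move=> ch; apply: (strictly_irreducible_or_factor mkv stat wis) => fact.
  exact: finite_factor_not_chaining ch.
- move=> irr; apply: (chaining_weakly_mixing mkv); exact: irr_ch.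
Qed.
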